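(* Let $\mathcal{S}$ be the set of positive integers that can be written as $x^2+y^2$ with $x,y$ integers, and let $p_\mathcal{S}(n)$ be the number of partitions of $n$ all of whose parts lie in $\mathcal{S}$. Let $\Phi(z)=\sum_{j=1}^\infty\sum_{\ell\in\mathcal{S}}\frac{1}{j}z^{j\ell}$ and $\Psi(z)=\exp(\Phi(z))$ for $|z|<1$, and for large $n$ let $\rho=\rho(n)\in(0,1)$ be the solution of $n=\rho\Phi'(\rho)$. Then, as $n\to\infty$, \[ p_\mathcal{S}(n+1)-p_\mathcal{S}(n)=\frac{\rho^{-n}\log(\frac{1}{\rho})\Psi(\rho)}{\sqrt{2\pi\Big\{\Big(\rho\frac{d}{d\rho}\Big)^2\Phi(\rho)\Big\}}}\Big(1+O(n^{-1/5})\Big). \]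
   Context: A partition of $n$ is a non-increasing sequence of positive integers summing to $n$. $\big(\rho\frac{d}{d\rho}\big)^2$ denotes applying the operator $\rho\frac{d}{d\rho}$ twice. The equation $n=\rho\Phi'(\rho)$ has a unique solution in $(0,1)$ for large $n$. *)

(* Defs.v *)
From HB Require Import structures.
From mathcomp Require Import all_boot all_order all_algebra finmap.
From mathcomp Require Import all_classical all_reals all_analysis.

Set Implicit Arguments.
Unset Strict Implicit.
Unset Printing Implicit Defensive.

Import Order.TTheory GRing.Theory Num.Theory.
Import numFieldNormedType.Exports.

Local Open Scope classical_set_scope.
Local Open Scope ring_scope.

Definition sums_of_two_squares : set nat :=
  [set l | (0 < l)%N /\ exists x y : int, l%:Z = x ^+ 2 + y ^+ 2].

Definition partitions_in (A : set nat) (n : nat) : set (seq nat) :=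
  [set s | [/\ sorted geq s, all (ltn 0) s, sumn s = n
             & forall k, k \in s -> A k]].

(* [fset_set] is empty on infinite sets, so the next definition relies on this
   lemma to be the intended cardinal. *)
Lemma finite_partitions_in (A : set nat) (n : nat) :
  finite_set (partitions_in A n).
Proof.
pose f (s : n.-bseq 'I_n.+1) : seq nat := map val (val s).
apply: (@sub_finite_set _ _ (f @` setT)); last first.
  by apply: finite_image; exact: finite_finset.
move=> s [_ s_gt0 s_sum _].
have size_s : (size s <= n)%N.
  rewrite -s_sum; elim: s s_gt0 {s_sum} => //= k s IHs /andP[k_gt0 /IHs].
  by rewrite -add1n; exact: leq_add.
have le_s k : k \in s -> (k < n.+1)%N.
  rewrite ltnS -s_sum; elim: s {s_gt0 s_sum size_s} => //= h s IHs.
  rewrite inE => /orP[/eqP->|/IHs/leq_trans]; first exact: leq_addr.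
  by apply; exact: leq_addl.
have size_t : (size [seq inord k : 'I_n.+1 | k <- s] <= n)%N by rewrite size_map.
exists (Bseq size_t) => //; rewrite /f /= -map_comp -[RHS]map_id.
by apply/eq_in_map => k /le_s; exact: inordK.
Qed.

Definition num_partitions_in (A : set nat) (n : nat) : nat :=
  #|` fset_set (partitions_in A n)|.

(* Only the values at real points matter here; outside of ]-1, 1[ the series
   diverges and the value is meaningless. *)
Definition Phi (R : realType) (z : R) : R :=
  \big[+%R/0]_(1 <= j <oo)
    \big[+%R/0]_(1 <= l <oo | l \in sums_of_two_squares) (j%:R^-1 * z ^+ (j * l)).

Definition Psi (R : realType) (z : R) : R := expR (Phi z).

Definition euler_op (R : realType) (f : R -> R) : R -> R :=
  fun x => x * derive1 f x.

(* Main.v *)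
(* Since p(n+1) - p(n) is the coefficient of z^(n+1) in (1 - z) Psi(z), it is an
   integral over the circle |z| = rho, and the saddle point of Psi is at rho.
   Put rho = exp(-al), sigma^2 = sum a_m m^2 rho^m and Q = sum a_m m^4 rho^m, where
   Phi(z) = sum a_m z^m.  For theta^2 <= 6 sigma^2 / Q, Taylor's formula compares the
   integrand with (1 - rho) Psi(rho) exp(- theta^2 sigma^2 / 2), with relative error
   of order Q / sigma^4 + 1 / (sigma (1 - rho))^2.

   No asymptotics for the counting function of S are needed, only Q = O(al^-5) and
   sigma^2 >= c al^(-11/4); the latter follows from the numbers a^2 + b^2 with
   0 <= b^2 <= 2 a, which are pairwise distinct.  The error is then O(al^(1/2)),
   which is O(n^(-1/4)) because n = O(al^-2).

   On the remaining arc the integrand is exponentially small because S contains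
   both k^2 and k^2 + h^2 for all k >= 1 and h: if |1 - exp(i h^2 theta)| is not small,
   then the phases of z^(k^2) and z^(k^2 + h^2) cannot both be close to 1, and h can
   be chosen with h^2 |theta| of order 1. *)
Require Import Defs.
From mathcomp Require Import all_boot all_order all_algebra finmap.
From mathcomp Require Import all_classical all_reals all_analysis.
From mathcomp Require Import ring lra zify.

Set Implicit Arguments.
Unset Strict Implicit.
Unset Printing Implicit Defensive.

Import Order.TTheory GRing.Theory Num.Theory.
Import numFieldNormedType.Exports.

Local Open Scope classical_set_scope.
Local Open Scope ring_scope.

(** * Absolutely summable real sequences *)

Section AbsolutelySummable.
Context {R : realType}.
Implicit Types f g h : nat -> R.

(** The exponent -11/4 has to beat -5/2: squares alone give only [sigma^2 >= c al^(-5/2)], for which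
    the estimate of [Q / sigma^4] is just O(1); the second square supplies the missing [al^(-1/4)].
    The same margin makes the exponent on the minor arc at least of order [al^(-1/4)], which beats
    every power of [al]. All analysis is real: a complex number is recorded by the real parts of its
    rotations. The product formula is built one factor at a time, for parts at most [L], before [L]
    tends to infinity by dominated convergence. The series is cut to a finite trigonometric
    polynomial before integrating, at a cost no larger than the minor-arc bound, so that
    orthogonality of finitely many cosines yields the coefficients. The arcs are not integrated
    separately: one bound, a wider Gaussian plus a constant, holds on the whole circle, and the
    comparison takes place on the whole line. The coefficient formula produces
    [rho^(-n-1) (1 - rho)] where the theorem has [rho^(-n) log(1/rho)]; their quotient is
    [(exp(al) - 1) / al = 1 + O(al)]. *)

Definition abs_summable f := cvgn (series (fun n => `|f n|)).
Definition tsum f : R := limn (series f).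

Lemma cvg_tsum f : abs_summable f -> series f @ \oo --> tsum f.
Proof. by move=> sf; apply: normed_cvg. Qed.

Lemma tsum_eq f x : series f @ \oo --> x -> tsum f = x.
Proof. exact: cvg_lim. Qed.

Lemma summable_norm f : abs_summable f -> abs_summable (fun n => `|f n|).
Proof. by rewrite /abs_summable; under [in X in _ -> X]eq_fun do rewrite normr_id. Qed.

Lemma summable_le g f :
  abs_summable g -> (forall n, `|f n| <= g n) -> abs_summable f.
Proof.
move=> sg fg; apply: (series_le_cvg _ _ _ sg) => n //.
exact: le_trans (ler_norm _).
Qed.

Lemma eq_tsum f g : f =1 g -> tsum f = tsum g.
Proof. by move=> fg; congr tsum; apply/funext. Qed.

Lemma summableZ k f : abs_summable f -> abs_summable (fun n => k * f n).
Proof.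
move=> sf; rewrite /abs_summable.
rewrite (_ : (fun n => `|k * f n|) = `|k| *: (fun n => `|f n|)).
  exact: is_cvg_seriesZ.
by apply/funext => n; rewrite normrM.
Qed.

Lemma summableD f g :
  abs_summable f -> abs_summable g -> abs_summable (fun n => f n + g n).
Proof.
move=> sf sg.
apply: (series_le_cvg _ _ _ (is_cvg_seriesD sf sg)) => n //=.
  by rewrite fctE addr_ge0.
by rewrite fctE ler_normD.
Qed.

Lemma tsumZ k f : abs_summable f -> tsum (fun n => k * f n) = k * tsum f.
Proof. by move=> /normed_cvg sf; have := lim_seriesZ k sf. Qed.

Lemma tsumD f g : abs_summable f -> abs_summable g ->
  tsum (fun n => f n + g n) = tsum f + tsum g.
Proof. by move=> /normed_cvg sf /normed_cvg sg; have := lim_seriesD sf sg. Qed.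

Lemma summableB f g :
  abs_summable f -> abs_summable g -> abs_summable (fun n => f n - g n).
Proof.
move=> sf /(@summableZ (-1)) sg; have := summableD sf sg.
by under eq_fun do rewrite mulN1r.
Qed.

Lemma tsumB f g : abs_summable f -> abs_summable g ->
  tsum (fun n => f n - g n) = tsum f - tsum g.
Proof. by move=> /normed_cvg sf /normed_cvg sg; have := lim_seriesB sf sg. Qed.

Lemma le_tsum f g : (forall n, f n <= g n) ->
  abs_summable f -> abs_summable g -> tsum f <= tsum g.
Proof. by move=> fg /normed_cvg sf /normed_cvg sg; exact: lim_series_le. Qed.

Lemma tsum_ge0 f : (forall n, 0 <= f n) -> abs_summable f -> 0 <= tsum f.
Proof.
move=> f0 sf; apply: limr_ge; first exact: normed_cvg.
by apply: nearW => n; rewrite /series/= sumr_ge0.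
Qed.

Lemma le_norm_tsum g f :
  (forall n, `|f n| <= g n) -> abs_summable g -> `|tsum f| <= tsum g.
Proof.
move=> fg sg; have sf := summable_le sg fg.
apply: le_trans (lim_series_norm sf) _.
by apply: lim_series_le => //; exact: normed_cvg.
Qed.

Lemma partial_le_tsum f n : (forall n, 0 <= f n) -> abs_summable f ->
  \sum_(0 <= k < n) f k <= tsum f.
Proof.
move=> f0 /normed_cvg sf; apply: (nondecreasing_cvgn_le _ sf n).
move=> a b ab; rewrite /series/= -(subnKC ab) {1}/index_iota subn0.
by rewrite /index_iota subn0 iotaD big_cat/= lerDl sumr_ge0.
Qed.

Lemma summable_bounded C f : (forall n, 0 <= f n) ->
  (forall n, \sum_(0 <= k < n) f k <= C) -> abs_summable f.
Proof.
move=> f0 fC; rewrite /abs_summable.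
rewrite (_ : (fun n => `|f n|) = f); last first.
  by apply/funext => n; rewrite ger0_norm.
apply: nondecreasing_is_cvgn.
  move=> a b ab; rewrite /series/= -(subnKC ab) {1}/index_iota subn0.
  by rewrite /index_iota subn0 iotaD big_cat/= lerDl sumr_ge0.
by exists C => _ [n _ <-]; exact: fC.
Qed.

Lemma tsum_le_bounded C f : (forall n, 0 <= f n) ->
  (forall n, \sum_(0 <= k < n) f k <= C) -> tsum f <= C.
Proof.
move=> f0 fC; have sf := summable_bounded f0 fC.
apply: limr_le; first exact: normed_cvg.
exact: nearW.
Qed.

Lemma summable_geometric r : 0 <= r < 1 -> abs_summable (fun n => r ^+ n).
Proof.
move=> /andP[r0 r1]; have := @is_cvg_geometric_series R 1 r.
rewrite ger0_norm// => /(_ r1); rewrite /abs_summable.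
rewrite (_ : (fun n => `|r ^+ n|) = geometric 1 r)//.
by apply/funext => n /=; rewrite mul1r ger0_norm// exprn_ge0.
Qed.

Lemma tsum_recl f : abs_summable f -> tsum f = f 0%N + tsum (fun n => f n.+1).
Proof.
move=> sf.
have h2 : series (fun n => f n.+1) @ \oo --> tsum f - f 0%N.
  rewrite (_ : series _ = (fun n => series f n.+1 - f 0%N)).
    apply: cvgB; last exact: cvg_cst.
    by have := cvg_tsum sf; rewrite -(cvg_shiftS (series f)).
  by apply/funext => n; rewrite /series/= big_nat_recl// addrC addKr.
by rewrite (tsum_eq h2) addrCA subrr addr0.
Qed.

Lemma summableS f : abs_summable f -> abs_summable (fun n => f n.+1).
Proof.
move=> sf; apply: (@summable_le (fun n => `|f n.+1|)) => //.
apply: (@summable_bounded (tsum (fun n => `|f n|))) => // n.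
apply: le_trans (@partial_le_tsum (fun n => `|f n|) n.+1 _ _) => //.
  by rewrite big_nat_recl//= lerDr.
exact: summable_norm.
Qed.


(** Delaying a sequence by [l] is multiplication of its generating function by [z^l]; this is how
    adjoining a part [l] acts on sums over [m]. *)
Lemma sum_delay l f n :
  \sum_(0 <= m < n) (if (l <= m)%N then f (m - l)%N else 0) =
  \sum_(0 <= m < n - l) f m.
Proof.
have [nl|ln] := leqP n l.
  rewrite (eqP nl) [RHS]big_geq// big_nat big1// => i /andP[_ i_n].
  by rewrite leqNgt (leq_trans i_n nl).
rewrite (@big_cat_nat _ _ _ l)//=; last exact: ltnW.
rewrite big_nat big1 ?add0r; last first.
  by move=> i /andP[_ il]; rewrite leqNgt il.
rewrite -{1}(add0n l) big_addn; apply: eq_bigr => i _.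
by rewrite leq_addl addnK.
Qed.

Lemma summable_delay l f : abs_summable f ->
  abs_summable (fun m => if (l <= m)%N then f (m - l)%N else 0).
Proof.
move=> sf; apply: (@summable_le (fun m => if (l <= m)%N then `|f (m - l)%N| else 0)); last first.
  by move=> n; case: ifP; rewrite // normr0.
apply: (@summable_bounded (tsum (fun n => `|f n|))) => [n|n].
  by case: ifP.
rewrite (sum_delay l (fun n => `|f n|)).
by apply: partial_le_tsum => //; exact: summable_norm.
Qed.

Lemma tsum_delay l f : abs_summable f ->
  tsum (fun m => if (l <= m)%N then f (m - l)%N else 0) = tsum f.
Proof.
elim: l f => [|l IH] f sf.
  by apply: eq_tsum => m; rewrite subn0.
rewrite tsum_recl ?add0r; last exact: summable_delay.
rewrite -(IH f sf); apply: eq_tsum => m.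
by rewrite ltnS subSS.
Qed.

Lemma cvg_tsum_tail f : abs_summable f ->
  tsum f - \sum_(0 <= k < n) f k @[n --> \oo] --> 0.
Proof.
move=> sf; rewrite -[X in _ --> X](subrr (tsum f)).
by apply: cvgB; [exact: cvg_cst|exact: cvg_tsum].
Qed.

Lemma summable_tail n f : abs_summable f ->
  abs_summable (fun m => if (n <= m)%N then f m else 0).
Proof.
move=> /summable_norm sf; apply: summable_le sf _ => m.
by case: ifP => //; rewrite normr0.
Qed.

Lemma tsum_split n f : abs_summable f ->
  tsum f = \sum_(0 <= k < n) f k + tsum (fun m => if (n <= m)%N then f m else 0).
Proof.
elim: n f => [|n IH] f sf.
  by rewrite big_geq// add0r.
rewrite big_nat_recl//= tsum_recl// (IH _ (summableS sf)).
rewrite -addrA; congr (_ + _); congr (_ + _).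
rewrite [RHS]tsum_recl ?add0r//; last exact: summable_tail.
Qed.

Lemma norm_tsum_sub_partial n f : abs_summable f ->
  `|tsum f - \sum_(0 <= k < n) f k| <=
  tsum (fun n => `|f n|) - \sum_(0 <= k < n) `|f k|.
Proof.
move=> sf; have sf' : abs_summable (fun n => `|f n|).
  exact: summable_norm.
rewrite (tsum_split n sf) (tsum_split n sf') addrAC subrr add0r addrAC subrr add0r.
apply: le_norm_tsum; last exact: summable_tail.
by move=> m; case: ifP => //; rewrite normr0.
Qed.

(* Dominated convergence for arrays whose m-th column is constant from row m on. *)
Lemma cvg_tsum_eventually (F : nat -> nat -> R) f g : abs_summable g ->
  (forall L m, `|F L m| <= g m) -> (forall m, `|f m| <= g m) ->
  (forall L m, (m <= L)%N -> F L m = f m) ->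
  tsum (F L) @[L --> \oo] --> tsum f.
Proof.
move=> sg Fg fg Ff.
have sF L : abs_summable (F L) by exact: summable_le sg (Fg L).
have sf : abs_summable f by exact: summable_le sg fg.
apply/cvgrPdist_lt => e e0.
have /cvgr_dist_lt/(_ (e / 2)) := cvg_tsum_tail sg.
rewrite divr_gt0// => /(_ isT); apply: filterS => L.
rewrite sub0r normrN => tl.
have h u : abs_summable u -> (forall m, `|u m| <= g m) ->
    `|tsum u - \sum_(0 <= k < L) u k| <= tsum g - \sum_(0 <= k < L) g k.
  move=> su ug.
  rewrite (tsum_split L su) (tsum_split L sg) addrAC subrr add0r addrAC subrr add0r.
  apply: le_norm_tsum; last exact: summable_tail.
  by move=> m; case: ifP => //; rewrite normr0.
have h1 := h _ (sF L) (Fg L); have h2 := h _ sf fg.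
have e1 : \sum_(0 <= k < L) F L k = \sum_(0 <= k < L) f k.
  by apply: eq_big_nat => k /andP[_ kL]; rewrite Ff// ltnW.
rewrite e1 in h1.
have := le_lt_trans (ler_norm _) tl => tl'.
rewrite (_ : tsum f - _ = (tsum f - \sum_(0 <= k < L) f k) -
  (tsum (F L) - \sum_(0 <= k < L) f k)); last by rewrite opprB addrA subrK.
apply: le_lt_trans (ler_normB _ _) _.
by rewrite (splitr e) ltrD// (le_lt_trans _ tl').
Qed.

(** The lower bounds for sums over S keep only a sparse family of indices; strict growth of [g]
    ensures that no index is counted twice. *)
Lemma sum_increasing_le f (g : nat -> nat) n : (forall n, 0 <= f n) ->
  (forall k, (g k < g k.+1)%N) ->
  \sum_(0 <= k < n) f (g k) <= \sum_(g 0%N <= m < g n) f m.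
Proof.
move=> f0 gi; elim: n => [|n IH]; first by rewrite !big_geq.
have g0 m : (g 0%N <= g m)%N.
  by elim: m => // m /leq_trans; apply; exact: ltnW.
rewrite big_nat_recr//= [leRHS](@big_cat_nat _ _ _ (g n)) ?g0 ?(ltnW (gi n))//=.
rewrite lerD// (@big_ltn _ _ _ (g n))// lerDl sumr_ge0//.
Qed.

Lemma sum_increasing_le_tsum f (g : nat -> nat) n : (forall n, 0 <= f n) ->
  abs_summable f -> (forall k, (g k < g k.+1)%N) ->
  \sum_(0 <= k < n) f (g k) <= tsum f.
Proof.
move=> f0 sf gi; apply: le_trans (partial_le_tsum (g n) f0 sf).
apply: le_trans (sum_increasing_le n f0 gi) _.
have g0 m : (g 0%N <= g m)%N.
  by elim: m => // m /leq_trans; apply; exact: ltnW.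
by rewrite [leRHS](@big_cat_nat _ _ _ (g 0%N))//= lerDr sumr_ge0.
Qed.

Lemma sum_multiples f l n : (0 < l)%N ->
  \sum_(0 <= m < n.+1) (if (l %| m)%N then f m else 0) =
  \sum_(0 <= j < (n %/ l).+1) f (j * l)%N.
Proof.
move=> l0; elim: n => [|n IH].
  by rewrite div0n !big_nat1 dvdn0 mul0n.
rewrite big_nat_recr//= IH divnS//.
case: ifPn => ln; last by rewrite add0n addr0.
rewrite add1n [RHS]big_nat_recr//=; congr (_ + f _).
by have := divnK ln; rewrite divnS// ln add1n => ->.
Qed.

Lemma cvg_sum_multiples f l (x : R) : (0 < l)%N ->
  series (fun j => f (j * l)%N) @ \oo --> x ->
  series (fun m => if (l %| m)%N then f m else 0) @ \oo --> x.
Proof.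
move=> l0 fx; rewrite -cvg_shiftS.
rewrite (_ : [sequence _]_n =
  (fun n => series (fun j => f (j * l)%N) n) \o (fun n => (n %/ l).+1)); last first.
  by apply/funext => n; rewrite /= /series/= sum_multiples.
apply: cvg_comp fx => A [N _ NA]; exists (N * l)%N => // n /= nN.
apply: NA => /=; rewrite ltnW// ltnS; by rewrite leq_divRL.
Qed.

End AbsolutelySummable.

(** * Partitions with bounded parts *)

Definition parts_upto (A : set nat) (L : nat) : set nat :=
  [set k | A k /\ (k <= L)%N].

Lemma part_le_sumn (s : seq nat) k : k \in s -> (k <= sumn s)%N.
Proof.
elim: s => //= h s IHs; rewrite inE => /orP[/eqP->|/IHs/leq_trans].
  exact: leq_addr.
by apply; exact: leq_addl.
Qed.

Lemma num_partitions_in_upto A L n : (n <= L)%N ->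
  num_partitions_in (parts_upto A L) n = num_partitions_in A n.
Proof.
move=> nL; rewrite /num_partitions_in; congr (#|` fset_set _|).
apply/seteqP; split => s [ss s0 sn sA]; split => // k ks.
  by have [] := sA _ ks.
split; first exact: sA.
by rewrite (leq_trans _ nL)// -sn part_le_sumn.
Qed.

Lemma num_partitions_in_upto0 A n :
  num_partitions_in (parts_upto A 0) n = (n == 0)%N.
Proof.
have [->|n0] := eqVneq n 0%N.
  rewrite /num_partitions_in (_ : partitions_in _ _ = [set [::]]).
    by rewrite fset_set1 cardfs1.
  apply/seteqP; split => [s [_ + + _]|_ ->]; last by split.
  by case: s => // a s /= /andP[a0 _]; move: a0; case: a.
rewrite /num_partitions_in (_ : partitions_in _ _ = set0).
  by rewrite fset_set0 cardfs0.
apply/seteqP; split => // s [_ s0 sn sA].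
case: s s0 sn sA => [|a s] /=; first by move=> _ n0'; rewrite -n0' eqxx in n0.
move=> /andP[a0 _] _ /(_ a); rewrite inE eqxx => /(_ isT)[_].
by rewrite leqNgt a0.
Qed.

Lemma num_partitions_in_uptoN A L n : ~ A L.+1 ->
  num_partitions_in (parts_upto A L.+1) n =
  num_partitions_in (parts_upto A L) n.
Proof.
move=> AL; congr num_partitions_in; apply/seteqP; split => k [Ak kL]; split => //.
  by move: kL; rewrite leq_eqVlt => /orP[/eqP kE|//]; rewrite kE in Ak.
exact: leqW.
Qed.

(** If the part [L.+1] occurs, it is the head of the non-increasing sequence, and removing it is a
    bijection. In terms of generating functions, [F_(L+1) = F_L + z^(L+1) F_(L+1)]. *)
Lemma num_partitions_in_uptoS A L n : A L.+1 ->
  num_partitions_in (parts_upto A L.+1) n =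
  (num_partitions_in (parts_upto A L) n +
   if (L < n)%N then num_partitions_in (parts_upto A L.+1) (n - L.+1) else 0)%N.
Proof.
move=> AL.
have sub : partitions_in (parts_upto A L) n `<=` partitions_in (parts_upto A L.+1) n.
  move=> s [ss s0 sn sA]; split => // k /sA[Ak kL]; split => //; exact: leqW.
case: ifPn => Ln; last first.
  rewrite addn0 /num_partitions_in; congr (#|` fset_set _|).
  apply/seteqP; split => // s [ss s0 sn sA]; split => // k ks.
  have [Ak _] := sA _ ks; split => //.
  by rewrite (leq_trans (part_le_sumn ks))// sn leqNgt.
set X := partitions_in (parts_upto A L) n.
set Y := partitions_in (parts_upto A L.+1) (n - L.+1).
have E : partitions_in (parts_upto A L.+1) n = X `|` (cons L.+1) @` Y.
  apply/seteqP; split => [s [ss s0 sn sA]|s].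
    case: s ss s0 sn sA => [|a s] /=.
      by move=> _ _ n0; rewrite -n0 in Ln.
    move=> ss /andP[a0 s0] sn sA.
    have [Aa aL] := sA a (mem_head _ _).
    have sa : all (geq a) s.
      by move: ss; rewrite path_sortedE => [/andP[]//|]; exact/rev_trans/leq_trans.
    move: (aL); rewrite leq_eqVlt => /orP[/eqP aE|aL'].
      right; exists s; last by rewrite aE.
      split => //.
      - exact: path_sorted ss.
      - by rewrite -sn aE addKn.
      - by move=> k ks; apply: sA; rewrite inE ks orbT.
    left; split => //=; first by rewrite a0.
    move=> k; rewrite inE => /orP[/eqP->//|ks]; split.
      by apply: (sA k _).1; rewrite inE ks orbT.
    by move: sa => /allP/(_ k ks)/= /leq_trans; apply.
  move=> [/sub//|[t [ts t0 tn tA] <-]]; split => /=.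
  - rewrite path_sortedE; last exact/rev_trans/leq_trans.
    by rewrite ts andbT; apply/allP => k /tA[].
  - exact: t0.
  - by rewrite tn subnKC.
  - by move=> k; rewrite inE => /orP[/eqP->|/tA//]; split.
have fX : finite_set X by exact: finite_partitions_in.
have fY : finite_set Y by exact: finite_partitions_in.
rewrite /num_partitions_in E fset_setU//; last exact: finite_image.
rewrite cardfsU -fset_setI//; last exact: finite_image.
rewrite (_ : X `&` _ = set0).
  rewrite fset_set0 cardfs0 subn0 fset_set_image//.
  by rewrite card_imfset//; move=> a b [].
apply/seteqP; split => // s [[_ _ _ sA] [t _ tE]].
have := sA L.+1; rewrite -tE mem_head => /(_ isT)[_].
by rewrite ltnn.
Qed.

(** * Elementary inequalities *)

Section TrigBounds.
Context {R : realType}.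
Implicit Types x y : R.

(** The Taylor bounds below form a chain in which each one has the previous one as its derivative,
    starting from [cos x <= 1]. *)
Lemma ge0_of_derive (f df : R -> R) : f 0 = 0 ->
  (forall x : R, is_derive x 1 f (df x)) -> (forall x, 0 <= x -> 0 <= df x) ->
  forall x, 0 <= x -> 0 <= f x.
Proof.
move=> f0 fd df0 x; rewrite le_eqVlt => /orP[/eqP<-|x0]; first by rewrite f0.
have [|c] := @MVT R f df 0 x x0 (fun y _ => fd y).
  apply: continuous_subspaceT => y; apply: differentiable_continuous.
  by apply/derivable1_diffP; have := fd y; move=> [].
rewrite in_itv/= => /andP[c0 _]; rewrite f0 !subr0 => ->.
by rewrite mulr_ge0 ?df0// ltW.
Qed.

Lemma sin_le_id x : 0 <= x -> sin x <= x.
Proof.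
move=> x0; rewrite -subr_ge0.
apply: (@ge0_of_derive (fun x => x - sin x) (fun x => 1 - cos x)) x0 => [|y _].
  by rewrite sin0 subr0.
by rewrite subr_ge0 cos_le1.
Qed.

Lemma cos_ge_taylor2 x : 1 - x ^+ 2 / 2 <= cos x.
Proof.
wlog x0 : x / 0 <= x.
  move=> h; have [/h//|/ltW x0] := leP 0 x.
  by rewrite -cosN -sqrrN; apply: h; rewrite oppr_ge0.
rewrite -subr_ge0.
apply: (@ge0_of_derive (fun x => cos x - (1 - x ^+ 2 / 2)) (fun x => x - sin x)) x0 => [|y|y y0].
- by rewrite cos0 expr0n/= mul0r subr0 subrr.
- apply: is_derive_eq.
  by rewrite /GRing.scale/=; field.
- by rewrite subr_ge0 sin_le_id.
Qed.

Lemma sin_ge_taylor3 x : 0 <= x -> x - x ^+ 3 / 6 <= sin x.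
Proof.
move=> x0; rewrite -subr_ge0.
apply: (@ge0_of_derive (fun x => sin x - (x - x ^+ 3 / 6))
  (fun x => cos x - (1 - x ^+ 2 / 2))) x0 => [|y|y y0].
- by rewrite sin0 expr0n/= mul0r !subr0.
- apply: is_derive_eq.
  by rewrite /GRing.scale/=; field.
- by rewrite subr_ge0 cos_ge_taylor2.
Qed.

Lemma cos_le_taylor4 x : cos x <= 1 - x ^+ 2 / 2 + x ^+ 4 / 24.
Proof.
wlog x0 : x / 0 <= x.
  move=> h; have [/h//|/ltW x0] := leP 0 x.
  have := h (- x); rewrite cosN sqrrN oppr_ge0 => /(_ x0).
  by rewrite (_ : (- x) ^+ 4 = x ^+ 4)//; ring.
rewrite -subr_ge0.
apply: (@ge0_of_derive (fun x => 1 - x ^+ 2 / 2 + x ^+ 4 / 24 - cos x)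
  (fun x => sin x - (x - x ^+ 3 / 6))) x0 => [|y|y y0].
- by rewrite cos0 !expr0n/= !mul0r subr0 addr0 subrr.
- apply: is_derive_eq.
  by rewrite /GRing.scale/=; field.
- by rewrite subr_ge0 sin_ge_taylor3.
Qed.

Lemma sin_sub_id_le x : `|sin x - x| <= `|x| ^+ 3 / 6.
Proof.
wlog x0 : x / 0 <= x.
  move=> h; have [/h//|/ltW x0] := leP 0 x.
  have := h (- x); rewrite sinN normrN oppr_ge0 => /(_ x0).
  by rewrite -opprD normrN.
have := sin_le_id x0; have := sin_ge_taylor3 x0.
rewrite (ger0_norm x0) => h1 h2; rewrite ler_norml; apply/andP; split; lra.
Qed.

Lemma sin_abs_le x : `|sin x| <= `|x|.
Proof.
wlog x0 : x / 0 <= x.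
  move=> h; have [/h//|/ltW x0] := leP 0 x.
  by have := h (- x); rewrite sinN !normrN oppr_ge0 => /(_ x0).
rewrite (ger0_norm x0) ler_norml sin_le_id// andbT.
have [x1|x1] := leP x 1.
  have := sin_ge_taylor3 x0; have : 0 <= 1 - x ^+ 2 by nra.
  nra.
by have := sin_geN1 x; lra.
Qed.

(** Since [1 - cos t] is half of [|1 - exp(i t)|^2], this is [|a - b|^2 <= 2 |a|^2 + 2 |b|^2] for
    [a = 1 - exp(i x)] and [b = 1 - exp(i y)]; the defect is [|a + b|^2], whose two components are
    the squares given to [nra]. *)
Lemma one_sub_cos_diff x y :
  1 - cos (x - y) <= 2 * ((1 - cos x) + (1 - cos y)).
Proof.
rewrite cosB; have := cos2Dsin2 x; have := cos2Dsin2 y.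
move: (cos x) (sin x) (cos y) (sin y) => a b c d h1 h2.
have := sqr_ge0 (2 - a - c); have := sqr_ge0 (b + d); nra.
Qed.

(** Raise [x / k <= exp(x / k)] to the power [k]. *)
Lemma pow_le_exp k x : 0 <= x -> x ^+ k <= k%:R ^+ k * expR x.
Proof.
move=> x0; case: k => [|k]; first by rewrite !expr0 mul1r -expR0 ler_expR.
have k0 : 0 < k.+1%:R :> R by rewrite ltr0n.
have -> : expR x = expR (x / k.+1%:R) ^+ k.+1.
  by rewrite -expRM_natr divfK// gt_eqF.
rewrite -exprMn; apply: lerXn2r.
- by rewrite nnegrE.
- by rewrite nnegrE mulr_ge0 ?expR_ge0.
rewrite -[leLHS](divfK (lt0r_neq0 k0)) [leLHS]mulrC ler_pM2l//.
by apply: le_trans (expR_ge1Dx _); rewrite lerDr.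
Qed.

End TrigBounds.

(** * Power series *)

Section ExpLogSeries.
Context {R : realType}.
Implicit Types s t phi psi : R.

Lemma summable_pow_geometric k (r : R) : 0 <= r < 1 ->
  abs_summable (fun m => m%:R ^+ k * r ^+ m).
Proof.
move=> /andP[r0 r1]; move: r0; rewrite le_eqVlt => /orP[/eqP<-|r0].
  apply: (@summable_bounded _ (0%:R ^+ k)) => n.
    by rewrite mulr_ge0 ?exprn_ge0.
  case: n => [|n]; first by rewrite big_geq// exprn_ge0.
  rewrite big_nat_recl//= expr0 mulr1 big1 ?addr0// => i _.
  by rewrite expr0n/= mulr0.
pose al := - ln r; have al0 : 0 < al by rewrite oppr_gt0 ln_lt0// r0.
have rE m : r ^+ m = expR (- (al * m%:R)).
  by rewrite -mulNr expRM_natr opprK lnK.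
(* Half of the exponential decay absorbs [m^k], the other half is a geometric series. *)
apply: (@summable_le _ (fun m => (k%:R ^+ k * (2 / al) ^+ k) * expR (- al / 2) ^+ m)).
  apply: summableZ; apply: summable_geometric.
  by rewrite expR_ge0/= -expR0 ltr_expR mulNr oppr_lt0 divr_gt0.
move=> m; rewrite ger0_norm; last by rewrite mulr_ge0 ?exprn_ge0// ltW.
rewrite rE -expRM_natr.
have e0 : 0 <= al * m%:R / 2 by rewrite !mulr_ge0// ltW.
have := pow_le_exp k e0.
have -> : m%:R ^+ k = (al * m%:R / 2) ^+ k * (2 / al) ^+ k :> R.
  by rewrite -exprMn; congr (_ ^+ _); field; rewrite gt_eqF.
move=> h.
have -> : expR (- al / 2 * m%:R) = expR (al * m%:R / 2) * expR (- (al * m%:R)).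
  by rewrite -expRD; congr expR; field.
rewrite [leRHS]mulrA ler_wpM2r ?expR_ge0// [leRHS]mulrAC ler_wpM2r//.
by rewrite exprn_ge0// divr_ge0// ltW.
Qed.

Lemma summable_pow_bound k (C : R) (c : nat -> R) (r : R) : 0 <= r < 1 ->
  (forall m, `|c m| <= C * m%:R ^+ k) -> abs_summable (fun m => c m * r ^+ m).
Proof.
move=> r01 cC; apply: (@summable_le _ (fun m => C * (m%:R ^+ k * r ^+ m))).
  by apply: summableZ; exact: summable_pow_geometric.
move=> m; have /andP[r0 _] := r01.
by rewrite normrM mulrA (ger0_norm (exprn_ge0 _ r0)) ler_wpM2r ?exprn_ge0.
Qed.

Lemma is_derive_power_series k (C : R) (c : nat -> R) (x : R) : 0 <= C -> `|x| < 1 ->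
  (forall m, `|c m| <= C * m%:R ^+ k) ->
  is_derive x 1 (fun x => tsum (fun m => c m * x ^+ m))
    (tsum (fun m => m.+1%:R * c m.+1 * x ^+ m)).
Proof.
(* [K] is the midpoint between [|x|] and 1: term-by-term differentiation asks for convergence of the
   series and of its first two formal derivatives at a point beyond [|x|]. *)
move=> C0 x1 cC; pose K := (`|x| + 1) / 2.
have K01 : 0 <= K < 1 by rewrite /K; have := normr_ge0 x; lra.
have Kx : `|x| < `|K|.
  by have /andP[K0 _] := K01; rewrite (ger0_norm K0) /K; lra.
(* Bounds in powers of [m + 1] rather than [m] keep their shape under formal differentiation, which
   shifts the index by one. *)
have bS (d : nat -> R) D j : 0 <= D -> (forall m, `|d m| <= D * (m%:R + 1) ^+ j) ->
    forall m, `|pseries_diffs d m| <= (D * 2 ^+ j) * (m%:R + 1) ^+ j.+1.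
  move=> D0 dD m; rewrite /pseries_diffs normrM ger0_norm// -natr1.
  apply: le_trans (ler_wpM2l _ (dD m.+1)) _; first by rewrite addr_ge0.
  rewrite (_ : D * 2 ^+ j * _ = (m%:R + 1) * (D * (2 * (m%:R + 1)) ^+ j)); last first.
    by rewrite exprMn exprS; ring.
  rewrite ler_wpM2l ?addr_ge0// ler_wpM2l// -natr1.
  by apply: lerXn2r; rewrite ?nnegrE; have := ler0n R m; lra.
have cb (d : nat -> R) D j : 0 <= D -> (forall m, `|d m| <= D * (m%:R + 1) ^+ j) ->
    cvgn (pseries d K).
  move=> D0 dD; apply: normed_cvg.
  have := summableD (@summableZ _ `|d 0%N| _ (summable_geometric K01))
    (@summableZ _ (D * 2 ^+ j) _ (@summable_pow_geometric j _ K01)).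
  move=> /summable_le; apply => m.
  have /andP[K0 _] := K01.
  rewrite mulrA -mulrDl normrM (ger0_norm (exprn_ge0 _ K0)) ler_wpM2r ?exprn_ge0//.
  case: m => [|m]; first by rewrite lerDl !mulr_ge0 ?exprn_ge0.
  rewrite -[leLHS]add0r lerD//; apply: le_trans (dD _) _.
  rewrite -mulrA ler_wpM2l// -exprMn -natr1.
  by apply: lerXn2r; rewrite ?nnegrE; have := ler0n R m; lra.
have c1 m : `|c m| <= C * (m%:R + 1) ^+ k.
  apply: le_trans (cC m) _; rewrite ler_wpM2l//.
  by apply: lerXn2r; rewrite ?nnegrE; have := ler0n R m; lra.
have c2 := bS _ _ _ C0 c1.
have C2 : 0 <= C * 2 ^+ k by rewrite mulr_ge0// exprn_ge0.
have c3 := bS _ _ _ C2 c2.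
have C3 : 0 <= C * 2 ^+ k * 2 ^+ k.+1 by rewrite mulr_ge0// exprn_ge0.
exact: (pseries_snd_diffs (cb _ _ _ C0 c1) (cb _ _ _ C2 c2) (cb _ _ _ C3 c3) Kx).
Qed.
End ExpLogSeries.

(** * The logarithmic series of one Euler factor, in real form *)

Section ExpLog.
Context {R : realType}.
Variable phi : R.

(** [u + i v] is [- log(1 - w)] for [w = s exp(i phi)]; the term [j = 0] vanishes because the
    inverse of 0 is 0. The derivative in [s] is [du + i dv = exp(i phi) / (1 - w)]. *)
Let u (s : R) := tsum (fun j => j%:R^-1 * cos (j%:R * phi) * s ^+ j).
Let v (s : R) := tsum (fun j => j%:R^-1 * sin (j%:R * phi) * s ^+ j).
Let du (s : R) := tsum (fun j => cos (j.+1%:R * phi) * s ^+ j).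
Let dv (s : R) := tsum (fun j => sin (j.+1%:R * phi) * s ^+ j).

Lemma abs_cos_le1 (x : R) : `|cos x| <= 1.
Proof. by rewrite ler_norml cos_geN1 cos_le1. Qed.

Lemma abs_sin_le1 (x : R) : `|sin x| <= 1.
Proof. by rewrite ler_norml sin_geN1 sin_le1. Qed.

Lemma inv_nat_mul_le1 (j : nat) (x : R) : `|x| <= 1 -> `|j%:R^-1 * x| <= 1.
Proof.
move=> x1; rewrite normrM -[leRHS]mulr1; apply: ler_pM => //.
rewrite ger0_norm ?invr_ge0//; case: j => [|j]; first by rewrite invr0.
by rewrite invf_le1// ler1n.
Qed.

Lemma is_derive_expR_comp (f : R -> R) (x df : R) :
  is_derive x 1 f df -> is_derive x 1 (fun x => expR (f x)) (expR (f x) * df).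
Proof. by move=> h; exact: (is_derive1_comp (is_derive_expR (f x)) h). Qed.

Lemma is_derive_cos_comp (f : R -> R) (x df : R) :
  is_derive x 1 f df -> is_derive x 1 (fun x => cos (f x)) (- sin (f x) * df).
Proof. by move=> h; exact: (is_derive1_comp (is_derive_cos (f x)) h). Qed.

Let summable_trig (g : R -> R) (s : R) : 0 <= s < 1 -> (forall x, `|g x| <= 1) ->
  abs_summable (fun j => g j.+1%:R * s ^+ j).
Proof.
move=> s01 g1; apply: (@summable_pow_bound _ 0 1) => // m.
by rewrite expr0 mulr1.
Qed.

Let u_derive (s : R) : 0 <= s < 1 -> is_derive s 1 u (du s).
Proof.
move=> /andP[s0 s1].
have -> : du s = tsum (fun m => m.+1%:R * (m.+1%:R^-1 * cos (m.+1%:R * phi)) * s ^+ m).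
  by apply: eq_tsum => m; rewrite mulrA divff// mul1r.
apply: (@is_derive_power_series _ 0 1 (fun j => j%:R^-1 * cos (j%:R * phi))) => //.
  by rewrite ger0_norm.
by move=> m; rewrite expr0 mulr1 inv_nat_mul_le1// abs_cos_le1.
Qed.

Let v_derive (s : R) : 0 <= s < 1 -> is_derive s 1 v (dv s).
Proof.
move=> /andP[s0 s1].
have -> : dv s = tsum (fun m => m.+1%:R * (m.+1%:R^-1 * sin (m.+1%:R * phi)) * s ^+ m).
  by apply: eq_tsum => m; rewrite mulrA divff// mul1r.
apply: (@is_derive_power_series _ 0 1 (fun j => j%:R^-1 * sin (j%:R * phi))) => //.
  by rewrite ger0_norm.
by move=> m; rewrite expr0 mulr1 inv_nat_mul_le1// abs_sin_le1.
Qed.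

(** One component of the geometric series identity [q = e + s e q] with [e = exp(i phi)]: advancing
    the index by one rotates by [phi], which the addition formulas express through [a] and [b]. *)
Let geom_rec (g h : R -> R) (a b s : R) : 0 <= s < 1 ->
  (forall x, `|g x| <= 1) -> (forall x, `|h x| <= 1) ->
  (forall x, g (x + 1) = a * g x + b * h x) ->
  tsum (fun j => g j.+1%:R * s ^+ j) =
  g 1 + s * (a * tsum (fun j => g j.+1%:R * s ^+ j) +
             b * tsum (fun j => h j.+1%:R * s ^+ j)).
Proof.
move=> s01 g1 h1 gE.
have sg := summable_trig s01 g1; have sh := summable_trig s01 h1.
rewrite {1}tsum_recl// expr0 mulr1; congr (_ + _).
rewrite -!tsumZ// -tsumD; [|exact: summableZ|exact: summableZ].
rewrite -tsumZ; last by apply: summableD; exact: summableZ.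
by apply: eq_tsum => j; rewrite -natr1 gE exprS; ring.
Qed.

Let tsum_pow0 (g : nat -> R) : tsum (fun j => j%:R^-1 * g j * 0 ^+ j) = 0.
Proof.
rewrite -[RHS](mul0r (tsum (fun j => (0 : R) ^+ j))) -tsumZ.
  by apply: eq_tsum => -[|j]; rewrite ?invr0 ?mul0r// expr0n/= !mulr0.
by apply: summable_geometric; rewrite lexx ltr01.
Qed.

(* This is [exp (sum w^j / j) (1 - w) = 1] for [w = s exp(i phi)], multiplied by
   [exp(- i psi)] and reduced to real parts. *)
Lemma exp_log_series (s psi : R) : 0 <= s < 1 ->
  expR (u s) * cos (v s - psi) - s * (expR (u s) * cos (v s - psi + phi)) = cos psi.
Proof.
move=> /andP[]; rewrite le_eqVlt => /orP[/eqP<- _|s0 s1].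
  have u0 : u 0 = 0 := tsum_pow0 (fun j => cos (j%:R * phi)).
  have v0 : v 0 = 0 := tsum_pow0 (fun j => sin (j%:R * phi)).
  by rewrite u0 v0 expR0 mul1r mul0r subr0 sub0r cosN.
(* [K] has derivative zero by the two components [E1] and [E2] of the geometric identity, so it
   keeps its value [cos psi] at 0. *)
pose K s := expR (u s) * (cos (v s - psi) - s * cos (v s - psi + phi)).
have Kd (x : R) : 0 <= x < 1 -> is_derive x 1 K 0.
  move=> x01; have ud := u_derive x01; have vd := v_derive x01.
  have vd1 : is_derive x 1 (fun x => v x - psi) (dv x).
    by apply: is_derive_eq; rewrite subr0.
  have vd2 : is_derive x 1 (fun x => v x - psi + phi) (dv x).
    by apply: is_derive_eq; rewrite addr0.
  have ed := is_derive_expR_comp ud.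
  have cd1 := is_derive_cos_comp vd1.
  have cd2 := is_derive_cos_comp vd2.
  have E1 : du x = cos phi + x * (cos phi * du x + (- sin phi) * dv x).
    have := @geom_rec (fun y => cos (y * phi)) (fun y => sin (y * phi)) (cos phi) (- sin phi) x x01.
    rewrite mul1r; apply => y; rewrite ?abs_cos_le1 ?abs_sin_le1//.
    by rewrite mulrDl mul1r cosD; ring.
  have E2 : dv x = sin phi + x * (cos phi * dv x + sin phi * du x).
    have := @geom_rec (fun y => sin (y * phi)) (fun y => cos (y * phi)) (cos phi) (sin phi) x x01.
    rewrite mul1r; apply => y; rewrite ?abs_cos_le1 ?abs_sin_le1//.
    by rewrite mulrDl mul1r sinD; ring.
  rewrite /K; apply: is_derive_eq.
  rewrite /GRing.scale/= !(cosD (v x - psi)) !(sinD (v x - psi)).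
  move: (cos (v x - psi)) (sin (v x - psi)) (expR (u x)) => c d e.
  move: E1 E2; move: (du x) (dv x) (cos phi) (sin phi) => p q f g E1 E2.
  suff : e * (c * (p - (f + x * (f * p + - g * q))) - d * (q - (g + x * (f * q + g * p)))) = 0.
    by move=> <-; ring.
  by rewrite -E1 -E2 !subrr; ring.
have [||c] := @MVT R K (fun _ => 0) 0 s s0.
- move=> x; rewrite in_itv/= => /andP[x0 xs]; apply: Kd.
  by rewrite ltW//= (lt_trans xs).
- apply: derivable_within_continuous => x; rewrite in_itv/= => /andP[x0 xs].
  by have [] : is_derive x 1 K 0 by apply: Kd; rewrite x0 (le_lt_trans xs).
move=> _; rewrite mul0r => /subr0_eq.
rewrite /K mul0r subr0.
have u0 : u 0 = 0 := tsum_pow0 (fun j => cos (j%:R * phi)).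
have v0 : v 0 = 0 := tsum_pow0 (fun j => sin (j%:R * phi)).
rewrite u0 v0.
by rewrite expR0 mul1r sub0r cosN => <-; ring.
Qed.

End ExpLog.

(** * The logarithm of the generating function *)

Section Coefficients.
Context {R : realType}.
Variable A : set nat.

(** The coefficient of [z^m] in the sum of [- log(1 - z^l)] over the [l <= L] in [A]: the term with
    [j l = m] contributes [1 / j = l / m]. At [m = 0] division by 0 makes it 0. *)
Definition divcoef (L m : nat) : R :=
  \sum_(1 <= l < L.+1 | l \in A) (if (l %| m)%N then l%:R / m%:R else 0).

Definition coef (m : nat) : R := divcoef m m.

Lemma divcoef_ge0 L m : 0 <= divcoef L m.
Proof. by apply: sumr_ge0 => l _; case: ifP => // _; rewrite divr_ge0. Qed.

Lemma coef_ge0 m : 0 <= coef m. Proof. exact: divcoef_ge0. Qed.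

Lemma divcoefS L m : divcoef L.+1 m = divcoef L m +
  if (L.+1 \in A) && (L.+1 %| m)%N then L.+1%:R / m%:R else 0.
Proof.
rewrite /divcoef big_mkcond big_nat_recr//= -big_mkcond; congr (_ + _).
by case: (L.+1 \in A).
Qed.

Lemma divcoef_stable L m : (m <= L)%N -> divcoef L m = coef m.
Proof.
elim: L => [|L IH]; first by rewrite leqn0 => /eqP->.
rewrite leq_eqVlt => /orP[/eqP->//|]; rewrite ltnS => mL.
rewrite divcoefS IH//; case: ifPn => [/andP[_]|_]; rewrite ?addr0//.
case: m mL {IH} => [|m] mL; first by rewrite invr0 mulr0 addr0.
by move=> /dvdn_leq => /(_ isT); rewrite leqNgt ltnS mL.
Qed.

Lemma divcoef_mono L L' m : (L <= L')%N -> divcoef L m <= divcoef L' m.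
Proof.
move=> /subnK<-; elim: (L' - L)%N => // k IH.
rewrite addSn divcoefS; apply: le_trans IH _; rewrite lerDl.
by case: ifP => // _; rewrite divr_ge0.
Qed.

Lemma divcoef_le_coef L m : divcoef L m <= coef m.
Proof.
have [Lm|/ltnW mL] := leqP L m; first exact: divcoef_mono.
by rewrite divcoef_stable.
Qed.

Lemma coef_le m : coef m <= m%:R.
Proof.
rewrite /coef /divcoef; apply: (@le_trans _ _ (\sum_(1 <= l < m.+1) 1)); last first.
  by rewrite sumr_const_nat subn1.
rewrite big_mkcond/=; apply: ler_sum_nat => l /andP[l0 lm].
case: ifP => // _; case: ifP => // _.
rewrite ler_pdivrMr ?mul1r ?ler_nat// ltr0n; lia.
Qed.

Lemma coef_ge1 m : (0 < m)%N -> A m -> 1 <= coef m.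
Proof.
case: m => // m _ Am; rewrite /coef divcoefS mem_set// dvdnn/=.
by rewrite divff// lerDr divcoef_ge0.
Qed.

Lemma summable_coef_pow k (r : R) : 0 <= r < 1 ->
  abs_summable (fun m => m%:R ^+ k * coef m * r ^+ m).
Proof.
move=> r01; apply: (@summable_pow_bound _ k.+1 1) => // m.
rewrite ger0_norm ?mulr_ge0 ?exprn_ge0 ?coef_ge0// mul1r exprSr.
by rewrite ler_wpM2l ?exprn_ge0// coef_le.
Qed.

Lemma summable_coef (r : R) : 0 <= r < 1 -> abs_summable (fun m => coef m * r ^+ m).
Proof.
move=> r01; have := @summable_coef_pow 0 r r01.
by under eq_fun do rewrite expr0 mul1r.
Qed.

Lemma summable_coef_bdd (g : nat -> R) (r : R) : 0 <= r < 1 ->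
  (forall m, `|g m| <= 1) -> abs_summable (fun m => coef m * r ^+ m * g m).
Proof.
move=> r01 g1; apply: (summable_le (summable_coef r01)) => m.
have c0 : 0 <= coef m * r ^+ m.
  by rewrite mulr_ge0 ?coef_ge0// exprn_ge0//; case/andP: r01.
by rewrite normrM (ger0_norm c0) -[leRHS]mulr1 ler_wpM2l.
Qed.

Lemma summable_divcoef_bdd L (g : nat -> R) (r : R) : 0 <= r < 1 ->
  (forall m, `|g m| <= 1) -> abs_summable (fun m => divcoef L m * r ^+ m * g m).
Proof.
move=> r01 g1; apply: (summable_le (summable_coef r01)) => m.
have r0 : 0 <= r ^+ m by rewrite exprn_ge0//; case/andP: r01.
rewrite normrM -[leRHS]mulr1 ler_pM//.
by rewrite ger0_norm ?mulr_ge0 ?divcoef_ge0// ler_wpM2r// divcoef_le_coef.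
Qed.

(** The part [L.+1] adds the logarithmic series of its own Euler factor, supported on multiples of
    [L.+1]; the weight [g] will be a cosine or a sine. *)
Lemma tsum_divcoefS L (g : nat -> R) (r : R) : 0 <= r < 1 ->
  (forall m, `|g m| <= 1) ->
  tsum (fun m => divcoef L.+1 m * r ^+ m * g m) =
  tsum (fun m => divcoef L m * r ^+ m * g m) +
  if L.+1 \in A then
    tsum (fun j => j%:R^-1 * g (j * L.+1)%N * (r ^+ L.+1) ^+ j) else 0.
Proof.
move=> r01 g1; have /andP[r0 r1] := r01.
have [AL|AL] := boolP (L.+1 \in A); last first.
  rewrite addr0; apply: eq_tsum => m.
  by rewrite divcoefS (negbTE AL)/= addr0.
pose f m := L.+1%:R / m%:R * r ^+ m * g m.
have rL : 0 <= r ^+ L.+1 < 1 by rewrite exprn_ge0// exprn_ilt1.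
have sj : abs_summable (fun j => j%:R^-1 * g (j * L.+1)%N * (r ^+ L.+1) ^+ j).
  apply: (@summable_pow_bound _ 0 1) => // m.
  by rewrite expr0 mulr1 inv_nat_mul_le1.
have fj : (fun j => j%:R^-1 * g (j * L.+1)%N * (r ^+ L.+1) ^+ j) =
    (fun j => f (j * L.+1)%N).
  apply/funext => -[|j]; rewrite /f.
    by rewrite mul0n [X in X^-1 * _](_ : _ = 0)// [X in _ / X](_ : _ = 0)// invr0 mulr0 !mul0r.
  rewrite -exprM (mulnC L.+1) natrM invfM mulrCA divff// mulr1.
  by rewrite mulrAC.
have := cvg_tsum sj; rewrite fj => /(cvg_sum_multiples (ltn0Sn L))/tsum_eq <-.
rewrite -tsumD; last 2 first.
- exact: summable_divcoef_bdd.
- apply: (summable_le (summable_coef r01)) => m.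
  have rm : 0 <= r ^+ m by rewrite exprn_ge0.
  case: ifP => mL; last by rewrite normr0 mulr_ge0 ?coef_ge0.
  rewrite normrM -[leRHS]mulr1 ler_pM//.
  rewrite ger0_norm ?mulr_ge0 ?divr_ge0// ler_wpM2r//.
  apply: le_trans (divcoef_le_coef L.+1 m).
  by rewrite divcoefS AL mL/= lerDr divcoef_ge0.
apply: eq_tsum => m; rewrite divcoefS AL/= /f.
by case: ifP => _; rewrite !mulrDl ?mul0r ?addr0.
Qed.

(** [Phi] is summed with [j] outside, so its coefficients come indexed by the codivisor [j = m / l];
    the involution [l |-> m / l] of the divisors of [m] matches the two forms. *)
Lemma coef_codiv m :
  \sum_(1 <= j < m.+1 | (j %| m)%N && ((m %/ j)%N \in A)) j%:R^-1 = coef m.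
Proof.
rewrite /coef /divcoef.
case: m => [|m]; first by rewrite !big_geq.
have h (P : pred nat) (F : nat -> R) : P 0%N = false ->
    \sum_(1 <= j < m.+2 | P j) F j = \sum_(j < m.+2 | P j) F j.
  by move=> P0; rewrite -(big_mkord P) [RHS]big_mkcond [RHS]big_ltn// P0/= add0r -big_mkcond.
rewrite h// [RHS](eq_bigr (fun l => if (l %| m.+1)%N then l%:R / m.+1%:R else 0))//.
rewrite -big_mkcondr h ?dvd0n ?andbF//.
have dK l : (l %| m.+1)%N -> (m.+1 %/ (m.+1 %/ l))%N = l.
  move=> lm; have l0 := dvdn_gt0 (ltn0Sn m) lm.
  rewrite -{1}(divnK lm) mulKn// divn_gt0//; exact: dvdn_leq.
have iK (l : nat) : nat_of_ord (inord (m.+1 %/ l) : 'I_m.+2) = (m.+1 %/ l)%N.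
  by rewrite inordK// ltnS leq_div.
rewrite (reindex_onto (fun l : 'I_m.+2 => inord (m.+1 %/ l))
  (fun j : 'I_m.+2 => inord (m.+1 %/ j))) /=; last first.
  by move=> j /andP[jm _]; apply: val_inj; rewrite /= !iK dK.
apply: eq_big => [l|l].
  rewrite iK; apply/idP/idP => [/andP[/andP[h1 h2] /eqP h3]|/andP[lA lm]].
    have lE : (m.+1 %/ (m.+1 %/ l))%N = l :> nat by rewrite -{2}h3 !iK.
    by rewrite lE in h2; rewrite h2/= -lE dvdn_div.
  by rewrite dvdn_div// dK// lA/= inord_val eqxx.
move=> /andP[/andP[h1 h2] /eqP h3].
have lE : (m.+1 %/ (m.+1 %/ l))%N = l :> nat by rewrite -{2}h3 !iK.
have lm : (l %| m.+1)%N by rewrite -lE dvdn_div// -iK.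
have e : m.+1%:R = (m.+1 %/ l)%:R * l%:R :> R by rewrite -natrM divnK.
rewrite iK e invfM mulrCA divff ?mulr1//.
by rewrite pnatr_eq0 -lt0n (dvdn_gt0 _ lm).
Qed.

End Coefficients.

(** * Phi as a power series and its Euler derivatives *)

Section PhiSeries.
Context {R : realType}.
Notation S := sums_of_two_squares.

Lemma notin_sums0 : (0%N \in S) = false.
Proof. by apply/negP; rewrite inE => -[]. Qed.

Lemma tsum_sum (F : nat -> nat -> R) n : (forall j, abs_summable (F j)) ->
  abs_summable (fun m => \sum_(1 <= j < n) F j m) /\
  \sum_(1 <= j < n) tsum (F j) = tsum (fun m => \sum_(1 <= j < n) F j m).
Proof.
move=> sF; have z : abs_summable (fun=> 0 : R).
  by apply: (@summable_bounded _ 0) => // k; rewrite big1.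
have tz : tsum (fun=> 0 : R) = 0.
  by rewrite -[RHS](mul0r (tsum (fun=> 0 : R))) -tsumZ//; apply: eq_tsum => ?; rewrite mul0r.
have base k : (k <= 1)%N -> abs_summable (fun m => \sum_(1 <= j < k) F j m) /\
    \sum_(1 <= j < k) tsum (F j) = tsum (fun m => \sum_(1 <= j < k) F j m).
  move=> k1; have -> : (fun m => \sum_(1 <= j < k) F j m) = (fun=> 0).
    by apply/funext => m; rewrite big_geq.
  by rewrite big_geq// tz.
elim: n => [|[|n] [s IH]]; [exact: base|exact: base|].
have -> : (fun m => \sum_(1 <= j < n.+2) F j m) =
    (fun m => \sum_(1 <= j < n.+1) F j m + F n.+1 m).
  by apply/funext => m; rewrite big_nat_recr.
rewrite big_nat_recr//= IH -tsumD//; split => //; exact: summableD.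
Qed.

(** The iterated limit becomes a single series because the m-th coefficient is complete once all
    [j <= m] are included, which is the situation of [cvg_tsum_eventually]. *)
Lemma Phi_tsum (z : R) : 0 <= z < 1 ->
  Phi z = tsum (fun m => coef S m * z ^+ m).
Proof.
move=> z01; have /andP[z0 z1] := z01.
pose g j m : R := if (j %| m)%N && ((m %/ j)%N \in S) then j%:R^-1 * z ^+ m else 0.
have sg j : abs_summable (g j).
  apply: (summable_le (summable_geometric z01)) => m.
  have zm : 0 <= z ^+ m by rewrite exprn_ge0.
  rewrite /g; case: ifP => _; last by rewrite normr0.
  rewrite mulrC normrM -[leRHS]mulr1 ler_pM// ?ger0_norm ?invr_ge0//.
  by have := @inv_nat_mul_le1 R j 1; rewrite normr1 mulr1 ger0_norm ?invr_ge0//; apply.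
have inner j : (0 < j)%N ->
    \big[+%R/0]_(1 <= l <oo | l \in S) (j%:R^-1 * z ^+ (j * l)) = tsum (g j).
  move=> j0; pose f m : R := if (m %/ j)%N \in S then j%:R^-1 * z ^+ m else 0.
  have sf : abs_summable (fun l => f (l * j)%N).
    have zj : 0 <= z ^+ j < 1 by rewrite exprn_ge0// exprn_ilt1// -lt0n.
    apply: (summable_le (summable_geometric zj)) => l.
    rewrite /f mulnK// -exprM mulnC; have zm : 0 <= z ^+ (j * l) by rewrite exprn_ge0.
    case: ifP => _; last by rewrite normr0.
    rewrite mulrC normrM -[leRHS]mulr1 ler_pM// ?ger0_norm ?invr_ge0//.
    by have := @inv_nat_mul_le1 R j 1; rewrite normr1 mulr1 ger0_norm ?invr_ge0//; apply.
  have := cvg_tsum sf => h; have h2 := cvg_sum_multiples j0 h.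
  have <- : tsum (fun l => f (l * j)%N) = tsum (g j).
    rewrite -(tsum_eq h2); apply: eq_tsum => m; rewrite /g /f.
    by case: (j %| m)%N.
  rewrite /tsum; congr (lim (_ @ \oo)); apply/funext => n.
  rewrite /series/= [LHS]big_mkcond/=.
  case: n => [|n]; first by rewrite !big_geq.
  rewrite [RHS]big_ltn// /f div0n notin_sums0 add0r.
  by apply: eq_bigr => l _; rewrite mulnK// mulnC.
rewrite /Phi.
have E n : \sum_(1 <= j < n) (\big[+%R/0]_(1 <= l <oo | l \in S) (j%:R^-1 * z ^+ (j * l)))
    = tsum (fun m => \sum_(1 <= j < n) g j m).
  rewrite -(tsum_sum n sg).2; apply: eq_big_nat => j /andP[j0 _]; exact: inner.
under eq_fun do rewrite E.
have Eg m : \sum_(1 <= j < m.+1) g j m = coef S m * z ^+ m.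
  rewrite -coef_codiv mulr_suml [RHS]big_mkcond/=; apply: eq_bigr => j _.
  by rewrite /g; case: ifP.
have g0 j m : 0 <= g j m.
  by rewrite /g; case: ifP => // _; rewrite mulr_ge0 ?invr_ge0 ?exprn_ge0.
have gS L m : (m < L)%N -> \sum_(1 <= j < L) g j m = coef S m * z ^+ m.
  move=> mL; rewrite (@big_cat_nat _ _ _ m.+1)//= Eg big_nat big1 ?addr0//.
  move=> j /andP[mj _]; rewrite /g; case: ifP => // /andP[jm].
  case: m mj jm {mL} => [|m] mj jm; first by rewrite div0n notin_sums0.
  by have := dvdn_leq (ltn0Sn m) jm; rewrite leqNgt mj.
apply: cvg_lim => //.
rewrite -(cvg_shiftS (fun n => tsum (fun m => \sum_(1 <= j < n) g j m))).
apply: (@cvg_tsum_eventually _ (fun L m => \sum_(1 <= j < L.+1) g j m) _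
  (fun m => coef S m * z ^+ m)).
- exact: summable_coef.
- move=> L m; rewrite ger0_norm ?sumr_ge0//.
  have [Lm|mL] := leqP L m; last by rewrite gS// ltnW.
  rewrite -Eg [leRHS](@big_cat_nat _ _ _ L.+1)//= lerDl sumr_ge0//.
- by move=> m; rewrite ger0_norm// mulr_ge0 ?coef_ge0 ?exprn_ge0.
- by move=> L m mL; rewrite gS.
Qed.

(** A derivative is local, so agreement with the series on ]0, 1[ suffices. In this form the lemma
    can be applied again to its own conclusion, with [m%:R * c m] for [c m]. *)
Lemma euler_op_power_series k (C : R) (c : nat -> R) (f : R -> R) (x : R) :
  0 <= C -> 0 < x < 1 -> (forall m, `|c m| <= C * m%:R ^+ k) ->
  (forall y, 0 < y < 1 -> f y = tsum (fun m => c m * y ^+ m)) ->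
  euler_op f x = tsum (fun m => m%:R * c m * x ^+ m).
Proof.
move=> C0 /andP[x0 x1] cC fE; rewrite /euler_op derive1E.
have nf : \near x, f x = tsum (fun m => c m * x ^+ m).
  have := near_in_itvoo; move=> /(_ R 0 1 x); rewrite in_itv/= x0 x1 => /(_ isT).
  by apply: filterS => y; rewrite in_itv/= => /fE.
rewrite (near_eq_derive _ nf).
have x1' : `|x| < 1 by rewrite gtr0_norm.
have [_ ->] := is_derive_power_series C0 x1' cC.
have x01 : 0 <= x < 1 by rewrite ltW.
have s1 : abs_summable (fun m => m%:R * c m * x ^+ m).
  apply: (@summable_pow_bound _ k.+1 C) => // m.
  by rewrite normrM ger0_norm// exprS mulrCA ler_wpM2l.
rewrite [RHS]tsum_recl// mul0r mul0r add0r -tsumZ.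
  by apply: eq_tsum => m; rewrite mulrCA -exprS.
have := summableZ (k := x^-1) (summableS s1).
congr abs_summable; apply/funext => m.
by rewrite mulrCA exprS mulKf// gt_eqF.
Qed.

End PhiSeries.

(** * The product formula for the partition generating function *)

Section GeneratingFunction.
Context {R : realType}.
Variables (A : set nat) (rho : R).
Hypothesis rho01 : 0 <= rho < 1.

Let P L m : R := (num_partitions_in (parts_upto A L) m)%:R.

Let P_le L m : P L m <= (num_partitions_in A m)%:R.
Proof.
have mono k : P k m <= P k.+1 m.
  have [AL|AL] := pselect (A k.+1); last by rewrite /P num_partitions_in_uptoN.
  by rewrite /P num_partitions_in_uptoS// ler_nat leq_addr.
have [Lm|/ltnW mL] := leqP L m; last by rewrite /P num_partitions_in_upto.
rewrite -(num_partitions_in_upto A (leqnn m)) -/(P m m).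
have monoD k : P L m <= P (k + L) m by elim: k => // k IH; exact: le_trans IH (mono _).
by have := monoD (m - L)%N; rewrite subnK.
Qed.

Let summable_P L : abs_summable (fun m => P L m * rho ^+ m).
Proof.
have /andP[r0 r1] := rho01.
have P0 L' m : 0 <= P L' m * rho ^+ m by rewrite mulr_ge0// exprn_ge0.
elim: L => [|L IH].
  apply: (summable_le (summable_geometric rho01)) => m.
  rewrite ger0_norm// /P num_partitions_in_upto0.
  by rewrite -[leRHS]mul1r ler_wpM2r ?exprn_ge0// lern1 leq_b1.
have [AL|AL] := pselect (A L.+1); last first.
  by move: IH; congr abs_summable; apply/funext => m; rewrite /P num_partitions_in_uptoN.
have rL : rho ^+ L.+1 < 1 by rewrite exprn_ilt1.
have rL0 : 0 <= rho ^+ L.+1 by rewrite exprn_ge0.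
(* The recursion applied to partial sums bounds them by [F_L(rho) / (1 - rho^(L+1))] before
   convergence of [F_(L+1)] is known. *)
apply: (@summable_bounded _ (tsum (fun m => P L m * rho ^+ m) / (1 - rho ^+ L.+1))) => // n.
rewrite ler_pdivlMr ?subr_gt0// mulrBr mulr1 lerBlDr.
apply: (@le_trans _ _ (\sum_(0 <= m < n) (P L m * rho ^+ m +
  if (L.+1 <= m)%N then P L.+1 (m - L.+1)%N * rho ^+ (m - L.+1) * rho ^+ L.+1 else 0))).
  apply: ler_sum => m _; rewrite /P num_partitions_in_uptoS// natrD mulrDl lerD2l.
  case: ifP => Lm; last by rewrite mul0r.
  by rewrite -mulrA -exprD subnK.
rewrite big_split/= lerD ?partial_le_tsum//.
rewrite (sum_delay L.+1 (fun m => P L.+1 m * rho ^+ m * rho ^+ L.+1)) mulr_suml.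
rewrite [leRHS](@big_cat_nat _ _ _ (n - L.+1))//= ?leq_subr// lerDl sumr_ge0//.
by move=> i _; rewrite mulr_ge0.
Qed.

Let summable_Pcos L (g : nat -> R) : (forall m, `|g m| <= 1) ->
  abs_summable (fun m => P L m * rho ^+ m * g m).
Proof.
move=> g1; apply: (@summable_le _ (fun m => P L m * rho ^+ m)) => [|m].
  exact: summable_P.
have /andP[r0 r1] := rho01.
by rewrite normrM -[leRHS]mulr1 ler_pM// ger0_norm// mulr_ge0// exprn_ge0.
Qed.

(* [H theta L psi] is the real part of [exp(- i psi) F_L(rho exp(i theta))], where [F_L]
   is the generating function for parts at most [L]; letting [psi] vary encodes the
   complex number [F_L], and multiplication by [z^l] becomes the shift
   [psi |-> psi - l theta]. *)
Let H (theta : R) L psi := tsum (fun m => P L m * rho ^+ m * cos (m%:R * theta - psi)).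
Let U theta L := tsum (fun m => divcoef A L m * rho ^+ m * cos (m%:R * theta)).
Let V theta L := tsum (fun m => divcoef A L m * rho ^+ m * sin (m%:R * theta)).

Let H_rec theta L psi : A L.+1 ->
  H theta L.+1 psi = H theta L psi + rho ^+ L.+1 * H theta L.+1 (psi - L.+1%:R * theta).
Proof.
move=> AL; pose f m := P L.+1 m * rho ^+ m * cos (m%:R * theta - (psi - L.+1%:R * theta)).
have sf : abs_summable f by apply: summable_Pcos => m; exact: abs_cos_le1.
rewrite /H -tsumZ// -(tsum_delay L.+1 (summableZ sf)) -tsumD.
- apply: eq_tsum => m; rewrite /P num_partitions_in_uptoS// natrD !mulrDl; congr (_ + _).
  case: ifP => Lm; last by rewrite !mul0r.
  rewrite /f -[in LHS](subnK Lm) addnK exprD natrD.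
  rewrite (_ : _ - psi = (m - L.+1)%:R * theta - (psi - L.+1%:R * theta)); last by ring.
  by move: (rho ^+ (m - L.+1)) (rho ^+ L.+1) => a b; rewrite /P; ring.
- by apply: summable_Pcos => m; exact: abs_cos_le1.
- by apply: (@summable_delay _ _ (fun m => rho ^+ L.+1 * f m)); exact: summableZ.
Qed.

Let H_closed theta L psi : H theta L psi = expR (U theta L) * cos (V theta L - psi).
Proof.
have /andP[r0 r1] := rho01.
have bcos m : `|cos (m%:R * theta)| <= 1 by exact: abs_cos_le1.
have bsin m : `|sin (m%:R * theta)| <= 1 by exact: abs_sin_le1.
elim: L psi => [|L IH] psi.
  have z g : tsum (fun m => divcoef A 0 m * rho ^+ m * g m) = 0 :> R.
    rewrite -[RHS](mul0r (tsum (fun m => rho ^+ m))) -tsumZ; last exact: summable_geometric.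
    by apply: eq_tsum => m; rewrite /divcoef big_geq// !mul0r.
  rewrite /U /V !z expR0 mul1r sub0r cosN /H.
  rewrite tsum_recl; last by apply: summable_Pcos => m; exact: abs_cos_le1.
  rewrite /P num_partitions_in_upto0 eqxx expr0 !mul1r mul0r sub0r cosN.
  rewrite -[RHS]addr0; congr (_ + _).
  rewrite -[RHS](mul0r (tsum (fun m => rho ^+ m))) -tsumZ; last exact: summable_geometric.
  by apply: eq_tsum => m; rewrite num_partitions_in_upto0 !mul0r.
have [AL|AL] := pselect (A L.+1); last first.
  have -> : H theta L.+1 psi = H theta L psi.
    by apply: eq_tsum => m; rewrite /P num_partitions_in_uptoN.
  rewrite IH /U /V !tsum_divcoefS//.
  by have /negbTE -> : L.+1 \notin A; [apply/negP; rewrite inE|rewrite !addr0].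
pose l := L.+1.
have rl : 0 <= rho ^+ l < 1 by rewrite exprn_ge0// exprn_ilt1.
have UE : U theta l = U theta L +
    tsum (fun j => j%:R^-1 * cos (j%:R * (l%:R * theta)) * (rho ^+ l) ^+ j).
  rewrite /U tsum_divcoefS// mem_set//; congr (_ + _); apply: eq_tsum => j.
  by rewrite natrM mulrA.
have VE : V theta l = V theta L +
    tsum (fun j => j%:R^-1 * sin (j%:R * (l%:R * theta)) * (rho ^+ l) ^+ j).
  rewrite /V tsum_divcoefS// mem_set//; congr (_ + _); apply: eq_tsum => j.
  by rewrite natrM mulrA.
pose G psi := expR (U theta l) * cos (V theta l - psi).
have G_rec p : G p = H theta L p + rho ^+ l * G (p - l%:R * theta).
  (* Multiplied by [expR (U theta L)], this identity says that the closed forms satisfy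
     [F_(L+1) - z^l F_(L+1) = F_L]. *)
  have := exp_log_series (l%:R * theta) (p - V theta L) rl.
  rewrite IH /G UE VE expRD; move: (tsum _) (tsum _) => v u h.
  have -> : cos (V theta L - p) = cos (p - V theta L) by rewrite -cosN opprB.
  rewrite -h.
  rewrite (_ : V theta L + v - p = v - (p - V theta L)); last by ring.
  rewrite (_ : V theta L + v - (p - l%:R * theta) =
    v - (p - V theta L) + l%:R * theta); last by ring.
  ring.
(* [H] and the closed form [G] satisfy the same recursion, so that their difference,
   being bounded, is damped by every power of [rho ^+ l]. *)
have D_iter k p : H theta l p - G p = (rho ^+ l) ^+ k *
    (H theta l (p - k%:R * (l%:R * theta)) - G (p - k%:R * (l%:R * theta))).
  elim: k p => [|k IHk] p; first by rewrite expr0 mul1r mul0r subr0.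
  rewrite IHk G_rec (H_rec _ _ AL) opprD addrACA subrr add0r -mulrBr (exprSr (rho ^+ l)) -mulrA.
  have kE : k.+1%:R = k%:R + 1 :> R by rewrite natr1.
  have -> : p - k.+1%:R * (l%:R * theta) = p - k%:R * (l%:R * theta) - l%:R * theta.
    by rewrite kE; ring.
  by [].
pose B := tsum (fun m => P l m * rho ^+ m) + expR (U theta l).
have DB p : `|H theta l p - G p| <= B.
  apply: le_trans (ler_normB _ _) _; apply: lerD.
    apply: le_norm_tsum; last exact: summable_P.
    move=> m; have Pr : 0 <= P l m * rho ^+ m by rewrite mulr_ge0// exprn_ge0.
    by rewrite normrM (ger0_norm Pr) -[leRHS]mulr1 ler_wpM2l// abs_cos_le1.
  by rewrite normrM (ger0_norm (expR_ge0 _)) -[leRHS]mulr1 ler_wpM2l ?expR_ge0// abs_cos_le1.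
have DG k : `|H theta l psi - G psi| <= B * (rho ^+ l) ^+ k.
  have rk : 0 <= (rho ^+ l) ^+ k by rewrite !exprn_ge0.
  by rewrite (D_iter k) normrM [leRHS]mulrC (ger0_norm rk) ler_wpM2l.
apply/eqP; rewrite -subr_eq0 -normr_le0.
have lim0 : B * (rho ^+ l) ^+ k @[k --> \oo] --> B * 0.
  apply: cvgMr; apply: cvg_expr.
  by rewrite ger0_norm; case/andP: rl.
rewrite mulr0 in lim0; rewrite -(cvg_lim _ lim0)//.
apply: limr_ge; first by apply/cvg_ex; exists 0.
by apply: nearW => k; exact: DG.
Qed.

(** At [theta = 0] the closed form bounds all partial sums by the exponential of the full series,
    which gives summability. The identity then follows as [L] tends to infinity, since counts and
    coefficients at [m] are stationary from [L = m] on. *)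
Lemma partition_series_eq_exp :
  abs_summable (fun m => (num_partitions_in A m)%:R * rho ^+ m) /\
  forall theta psi,
    tsum (fun m => (num_partitions_in A m)%:R * rho ^+ m * cos (m%:R * theta - psi)) =
    expR (tsum (fun m => coef A m * rho ^+ m * cos (m%:R * theta))) *
    cos (tsum (fun m => coef A m * rho ^+ m * sin (m%:R * theta)) - psi).
Proof.
have /andP[r0 r1] := rho01.
have p0 m : 0 <= (num_partitions_in A m)%:R * rho ^+ m by rewrite mulr_ge0// exprn_ge0.
have sc : abs_summable (fun m => coef A m * rho ^+ m) by exact: summable_coef.
have Pp L m : (m <= L)%N -> P L m = (num_partitions_in A m)%:R.
  by move=> mL; rewrite /P num_partitions_in_upto.
have sp : abs_summable (fun m => (num_partitions_in A m)%:R * rho ^+ m).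
  apply: (@summable_bounded _ (expR (tsum (fun m => coef A m * rho ^+ m)))) => // n.
  have -> : \sum_(0 <= k < n) (num_partitions_in A k)%:R * rho ^+ k =
      \sum_(0 <= k < n) P n k * rho ^+ k.
    by apply: eq_big_nat => k /andP[_ kn]; rewrite Pp// ltnW.
  have Pn0 m : 0 <= P n m * rho ^+ m by rewrite mulr_ge0// exprn_ge0.
  apply: (@le_trans _ _ (tsum (fun m => P n m * rho ^+ m))).
    by apply: partial_le_tsum => //; exact: summable_P.
  have := H_closed 0 n 0; rewrite /H.
  under eq_tsum do rewrite mulr0 subr0 cos0 mulr1.
  move=> ->; apply: (@le_trans _ _ (expR (U 0 n))).
    by rewrite -[leRHS]mulr1 ler_wpM2l ?expR_ge0// cos_le1.
  rewrite ler_expR /U; under eq_tsum do rewrite mulr0 cos0 mulr1.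
  apply: le_tsum; last exact: summable_coef.
    by move=> m; rewrite ler_wpM2r ?exprn_ge0// divcoef_le_coef.
  apply: (summable_le sc) => m.
  by rewrite ger0_norm ?mulr_ge0 ?exprn_ge0 ?divcoef_ge0// ler_wpM2r ?exprn_ge0// divcoef_le_coef.
split=> // theta psi.
have Hl : H theta L psi @[L --> \oo] -->
    tsum (fun m => (num_partitions_in A m)%:R * rho ^+ m * cos (m%:R * theta - psi)).
  apply: (cvg_tsum_eventually sp) => [L m|m|L m mL].
  - have Pr : 0 <= P L m * rho ^+ m by rewrite mulr_ge0// exprn_ge0.
    rewrite normrM (ger0_norm Pr) -[leRHS]mulr1 ler_pM// ?abs_cos_le1//.
    by rewrite ler_wpM2r ?exprn_ge0// P_le.
  - by rewrite normrM (ger0_norm (p0 m)) -[leRHS]mulr1 ler_wpM2l// abs_cos_le1.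
  - by rewrite Pp.
have UV (g : nat -> R) : (forall m, `|g m| <= 1) ->
    tsum (fun m => divcoef A L m * rho ^+ m * g m) @[L --> \oo] -->
    tsum (fun m => coef A m * rho ^+ m * g m).
  move=> g1; apply: (cvg_tsum_eventually sc) => [L m|m|L m mL].
  - have Pr : 0 <= divcoef A L m * rho ^+ m by rewrite mulr_ge0 ?divcoef_ge0// exprn_ge0.
    rewrite normrM (ger0_norm Pr) -[leRHS]mulr1 ler_pM//.
    by rewrite ler_wpM2r ?exprn_ge0// divcoef_le_coef.
  - have Pr : 0 <= coef A m * rho ^+ m by rewrite mulr_ge0 ?coef_ge0// exprn_ge0.
    by rewrite normrM (ger0_norm Pr) -[leRHS]mulr1 ler_wpM2l.
  - by rewrite divcoef_stable.
have Ul := UV _ (fun m => abs_cos_le1 (m%:R * theta)).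
have Vl := UV _ (fun m => abs_sin_le1 (m%:R * theta)).
have HE : (fun L => H theta L psi) = (fun L => expR (U theta L) * cos (V theta L - psi)).
  by apply/funext => L; exact: H_closed.
rewrite HE in Hl; apply: (cvg_unique _ Hl) => //.
apply: cvgM; first by apply: cvg_comp Ul _; exact: continuous_expR.
apply: (@cvg_comp _ _ _ (fun L => V theta L - psi) cos); last exact: continuous_cos.
by apply: cvgB => //; exact: cvg_cst.
Qed.

End GeneratingFunction.

(** * Moments of the coefficients of Phi *)

Section Moments.
Context {R : realType}.
Notation S := sums_of_two_squares.

(** The value at [rho = exp(- al)] of [Phi] after [k] applications of the Euler operator; [moment 2]
    and [moment 4] are [sigma^2] and [Q] of the overview. *)
Definition moment (k : nat) (al : R) : R :=
  tsum (fun m => m%:R ^+ k * coef S m * expR (- al) ^+ m).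

Lemma expRN_itv (al : R) : 0 < al -> 0 <= expR (- al) < 1.
Proof. by move=> a0; rewrite expR_ge0 -expR0 ltr_expR oppr_lt0. Qed.

Lemma summable_moment k (al : R) : 0 < al ->
  abs_summable (fun m => m%:R ^+ k * coef S m * expR (- al) ^+ m).
Proof. by move=> a0; apply: summable_coef_pow; exact: expRN_itv. Qed.

Lemma moment_term_ge0 k (al : R) m : 0 <= m%:R ^+ k * coef S m * expR (- al) ^+ m.
Proof. by rewrite !mulr_ge0 ?exprn_ge0 ?coef_ge0 ?expR_ge0. Qed.

Lemma sum_geometric_le (q : R) n : 0 <= q < 1 ->
  \sum_(0 <= j < n) q ^+ j <= (1 - q)^-1.
Proof.
move=> /andP[q0 q1]; rewrite -[leRHS]mul1r ler_pdivlMr ?subr_gt0//.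
have -> : (\sum_(0 <= j < n) q ^+ j) * (1 - q) = 1 - q ^+ n.
  elim: n => [|n IH]; first by rewrite big_geq// mul0r expr0 subrr.
  by rewrite big_nat_recr//= mulrDl IH exprSr; ring.
by rewrite gerBl exprn_ge0.
Qed.

Lemma sum_geometric_multiples_le (al : R) l n : 0 < al -> (0 < l)%N ->
  \sum_(0 <= m < n) (if (l %| m)%N then (if m == 0%N then 0 else expR (- al) ^+ m) else 0)
  <= (expR (al * l%:R) - 1)^-1.
Proof.
move=> a0 l0; case: n => [|n].
  by rewrite big_geq// invr_ge0 subr_ge0 -expR0 ler_expR mulr_ge0// ltW.
rewrite (sum_multiples (fun m => if m == 0%N then 0 else expR (- al) ^+ m))//.
rewrite big_nat_recl//= add0r.
pose q := expR (- al) ^+ l.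
have qE : q = expR (- (al * l%:R)) by rewrite /q -expRM_natr mulNr.
have e0 : 0 < al * l%:R by rewrite mulr_gt0// ltr0n.
have q01 : 0 <= q < 1 by rewrite qE expRN_itv.
have q0 : 0 < q by rewrite qE expR_gt0.
rewrite (eq_bigr (fun i => q * q ^+ i)); last first.
  by move=> i _; rewrite gtn_eqF ?muln_gt0// -exprS /q -exprM mulnC.
rewrite -mulr_sumr; apply: le_trans (ler_wpM2l (ltW q0) (sum_geometric_le _ q01)) _.
have -> : expR (al * l%:R) = q^-1 by rewrite qE -expRN opprK.
have -> : q^-1 - 1 = (1 - q) / q by field; rewrite gt_eqF.
by rewrite invf_div.
Qed.

Lemma mom1_coef_le n (al : R) m : 0 < al -> (m < n)%N ->
  m%:R ^+ 1 * coef S m * expR (- al) ^+ m <= \sum_(1 <= l < n)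
    l%:R * (if (l %| m)%N then (if m == 0%N then 0 else expR (- al) ^+ m) else 0).
Proof.
move=> a0 mn; case: m mn => [|m] mn.
  rewrite expr1 !mul0r sumr_ge0// => l _; rewrite mulr_ge0//.
  by case: ifP => // _; case: ifP => // _; rewrite exprn_ge0// expR_ge0.
rewrite /coef /divcoef mulr_sumr mulr_suml big_mkcond/=.
rewrite [leRHS](@big_cat_nat _ _ _ m.+2)//= -[leLHS]addr0 lerD//; last first.
  by apply: sumr_ge0 => l _; rewrite mulr_ge0//; case: ifP => // _; rewrite exprn_ge0// expR_ge0.
apply: ler_sum => l _.
have e0 : 0 <= expR (- al) ^+ m.+1 by rewrite exprn_ge0// expR_ge0.
case: ifP => lS; last by rewrite mulr_ge0//; case: ifP.
case: ifP => _; last by rewrite mulr0 mul0r mulr_ge0.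
by rewrite expr1 mulrCA divff// mulr1.
Qed.

(** [m * coef S m] is the sum of the divisors of [m] in S. Admitting all divisors and exchanging
    sums leaves [sum_l l / (exp(al l) - 1)], whose terms are at most [(2 / al) exp(- al l / 2)], a
    geometric series. *)
Lemma moment1_le (al : R) : 0 < al -> moment 1 al <= 4 / al ^+ 2.
Proof.
move=> a0; apply: tsum_le_bounded => [m|n]; first exact: moment_term_ge0.
apply: (@le_trans _ _ (\sum_(0 <= m < n) \sum_(1 <= l < n)
    l%:R * (if (l %| m)%N then (if m == 0%N then 0 else expR (- al) ^+ m) else 0))).
  by apply: ler_sum_nat => m /andP[_ mn]; exact: mom1_coef_le.
rewrite exchange_big_nat/=.
have p2 : 0 <= 2 / al by rewrite divr_ge0// ltW.
pose q := expR (- (al / 2)).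
have a2 : 0 < al / 2 by rewrite divr_gt0.
have q01 : 0 <= q < 1 by exact: expRN_itv.
apply: (@le_trans _ _ (\sum_(1 <= l < n) 2 / al * q ^+ l)).
  apply: ler_sum_nat => l /andP[l0 _]; rewrite -mulr_sumr.
  apply: le_trans (ler_wpM2l _ (sum_geometric_multiples_le _ a0 l0)) _ => //.
  pose y := al / 2 * l%:R.
  have l0' : 0 < l%:R :> R by rewrite ltr0n.
  have y0 : 0 < y by rewrite mulr_gt0.
  have -> : expR (al * l%:R) = expR y ^+ 2 by rewrite -expRM_natr /y; congr expR; field.
  have -> : q ^+ l = (expR y)^-1 by rewrite /q -expRM_natr mulNr expRN.
  have := expR_ge1Dx y; move: (expR y) => e h.
  have e1 : 1 < e by lra.
  have d0 : 0 < e ^+ 2 - 1 by nra.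
  rewrite ler_pdivrMr// mulrAC ler_pdivlMr; last by lra.
  apply: (@le_trans _ _ (2 / al * (y * e))); last first.
    by rewrite ler_wpM2l//; nra.
  by rewrite /y le_eqVlt; apply/orP; left; apply/eqP; field; rewrite gt_eqF.
rewrite -mulr_sumr; case: n => [|n].
  by rewrite big_geq// mulr0 divr_ge0 ?exprn_ge0// ltW.
rewrite big_add1/= (eq_bigr (fun i => q * q ^+ i)); last by move=> i _; rewrite exprS.
rewrite -mulr_sumr.
have /andP[q0 q1] := q01.
apply: (@le_trans _ _ (2 / al * (q * (1 - q)^-1))).
  by rewrite ler_wpM2l// ler_wpM2l// sum_geometric_le.
have -> : 4 / al ^+ 2 = 2 / al * (2 / al) by field; rewrite gt_eqF.
rewrite ler_wpM2l// ler_pdivrMr ?subr_gt0//.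
have := expR_ge1Dx (al / 2); have -> : expR (al / 2) = q^-1 by rewrite /q expRN invrK.
have qp : 0 < q by rewrite expR_gt0.
rewrite -(ler_pM2r qp) mulVf ?gt_eqF// => h.
have h2 : q * al <= 2 * (1 - q) by nra.
by rewrite mulrAC ler_pdivlMr.
Qed.

Definition quartic_const : R := 216 * 16.

Lemma quartic_const_ge1 : 1 <= quartic_const.
Proof. by rewrite /quartic_const; lra. Qed.

(** Half of the decay pays for three powers of [m]: [m^3 exp(- al m / 2) <= 216 / al^3] with
    [216 = 2^3 * 3^3]. What remains is [moment 1] at [al / 2], which is at most [16 / al^2]. *)
Lemma moment4_le (al : R) : 0 < al -> moment 4 al <= quartic_const / al ^+ 5.
Proof.
move=> a0; have a2 : 0 < al / 2 by rewrite divr_gt0.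
apply: (@le_trans _ _ (216 / al ^+ 3 * moment 1 (al / 2))); last first.
  have -> : quartic_const / al ^+ 5 = 216 / al ^+ 3 * (4 / (al / 2) ^+ 2).
    by rewrite /quartic_const; field; rewrite gt_eqF.
  apply: ler_wpM2l; last exact: moment1_le.
  by rewrite divr_ge0// exprn_ge0// ltW.
rewrite /moment -tsumZ; last exact: summable_moment.
apply: le_tsum; [|exact: summable_moment|exact/summableZ/summable_moment].
move=> m; have y0 : 0 <= al / 2 * m%:R by rewrite mulr_ge0// ltW.
have := pow_le_exp 3 y0.
have -> : expR (- al) ^+ m = expR (- (al / 2)) ^+ m * (expR (al / 2 * m%:R))^-1.
  by rewrite -!expRM_natr -expRN -expRD; congr expR; field.
have := expR_gt0 (al / 2 * m%:R); move: (expR (al / 2 * m%:R)) => e e0 h.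
have c0 := coef_ge0 (R := R) S m; have q0 : 0 <= expR (- (al / 2)) ^+ m.
  by rewrite exprn_ge0// expR_ge0.
rewrite (_ : _ * _ * (_ * _) = (m%:R ^+ 3 / e) * (m%:R ^+ 1 * coef S m * expR (- (al / 2)) ^+ m)).
  apply: ler_wpM2r; first by rewrite !mulr_ge0.
  rewrite ler_pdivrMr// mulrAC ler_pdivlMr ?exprn_gt0//.
  have : (al * m%:R) ^+ 3 <= 8 * (3%:R ^+ 3 * e).
    by rewrite (_ : (al * m%:R) ^+ 3 = 8 * (al / 2 * m%:R) ^+ 3) ?ler_wpM2l//; field.
  by rewrite exprMn mulrC (_ : 8 * (3%:R ^+ 3 * e) = 216 * e)//; ring.
move: (coef S m) (expR _ ^+ m) => c q; field; exact: lt0r_neq0.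
Qed.

Lemma sum_blocks (h : nat -> nat) (f : nat -> R) n : (forall a, (h a <= h a.+1)%N) ->
  \sum_(0 <= a < n) \sum_(h a <= m < h a.+1) f m = \sum_(h 0%N <= m < h n) f m.
Proof.
move=> hS; have h0 k : (h 0%N <= h k)%N by elim: k => // k /leq_trans; exact.
elim: n => [|n IH]; first by rewrite !big_geq.
by rewrite big_nat_recr//= IH [RHS](@big_cat_nat _ _ _ (h n)).
Qed.

Lemma sum_sq_in_S (a b : nat) : (0 < a)%N -> S (a ^ 2 + b ^ 2)%N.
Proof.
move=> a0; split; first by rewrite addn_gt0 expn_gt0 a0.
by exists a%:Z, b%:Z; rewrite -!mulnn PoszD !PoszM !expr2.
Qed.

(* Here and below [B] is an integer of order [al^(-1/4)], so that all estimates are in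
   powers of [B]; the bound counts the numbers [a^2 + b^2], [B^2 <= a < 2 B^2], [b < B]. *)
Lemma moment2_ge (al : R) (B : nat) : 0 < al -> (0 < B)%N ->
  B%:R ^+ 4 * al <= 1 -> B%:R ^+ 11 * expR (- 5) <= moment 2 al.
Proof.
move=> a0 B0 Bal.
pose f m : R := m%:R ^+ 2 * coef S m * expR (- al) ^+ m.
have f0 m : 0 <= f m by exact: moment_term_ge0.
have sf : abs_summable f by exact: summable_moment.
(* Distinctness of the numbers [(B^2 + a)^2 + b^2]: since [b^2 < B^2], each lies in the block from
   [h a] to [h a.+1], and within a block they increase with [b]. *)
pose h a := ((B ^ 2 + a) ^ 2)%N.
have hS a : (h a <= h a.+1)%N by rewrite /h leq_exp2r// leq_add2l.
apply: (@le_trans _ _ (\sum_(0 <= a < B ^ 2) \sum_(0 <= b < B) f ((B ^ 2 + a) ^ 2 + b ^ 2)%N)).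
  (* There are [B^3] pairs, and each resulting number lies between [B^4] and [5 B^4], so its term is
     at least [B^8 exp(- 5)]. *)
  have E : B%:R ^+ 11 * expR (- 5) =
      \sum_(0 <= a < B ^ 2) \sum_(0 <= b < B) (B%:R ^+ 8 * expR (- 5)) :> R.
    by rewrite !sumr_const_nat !subn0 -mulrnA -[RHS]mulr_natl natrM natrX; ring.
  rewrite E; apply: ler_sum_nat => a /andP[_ aB]; apply: ler_sum_nat => b /andP[_ bB].
  set l := (_ + _)%N.
  have l0 : (0 < B ^ 2 + a)%N by rewrite addn_gt0 expn_gt0 B0.
  have lS := sum_sq_in_S b l0.
  have l1 : (B ^ 4 <= l)%N.
    rewrite /l (_ : B ^ 4 = (B ^ 2) ^ 2)%N; last by rewrite -expnM.
    by apply: leq_trans (leq_addr _ _); rewrite leq_exp2r// leq_addr.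
  have l2 : (l <= 5 * B ^ 4)%N.
    rewrite /l (_ : B ^ 4 = (B ^ 2) ^ 2)%N; last by rewrite -expnM.
    have b2 : (b ^ 2 <= B ^ 2)%N by rewrite leq_exp2r// ltnW.
    move: aB b2; have : (0 < B ^ 2)%N by rewrite expn_gt0 B0.
    move: (B ^ 2)%N (b ^ 2)%N => x y; rewrite -!mulnn; nia.
  have l0' : (0 < l)%N by rewrite /l addn_gt0 expn_gt0 l0.
  rewrite /f -expRM_natr; apply: ler_pM.
  - by rewrite exprn_ge0.
  - exact: expR_ge0.
  - rewrite -[leLHS]mulr1; apply: ler_pM => //.
      rewrite (_ : B%:R ^+ 8 = (B ^ 4)%:R ^+ 2 :> R); last by rewrite natrX -exprM.
      by apply: lerXn2r; rewrite ?nnegrE// ler_nat.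
    exact: coef_ge1.
  - rewrite ler_expR mulNr lerN2.
    have : l%:R <= 5 * B%:R ^+ 4 :> R by rewrite -natrX -natrM ler_nat.
    nra.
apply: le_trans (@partial_le_tsum _ f (h (B ^ 2)%N) f0 sf).
rewrite [leRHS](@big_cat_nat _ _ _ (h 0%N))//=; last first.
  by rewrite /h leq_exp2r// leq_add2l.
rewrite -[leLHS]add0r lerD ?sumr_ge0// -sum_blocks//.
apply: ler_sum_nat => a /andP[_ aB].
have g1 b : ((B ^ 2 + a) ^ 2 + b ^ 2 < (B ^ 2 + a) ^ 2 + b.+1 ^ 2)%N.
  by rewrite ltn_add2l ltn_exp2r.
apply: le_trans (sum_increasing_le B f0 g1) _.
rewrite exp0n// addn0 -/(h a) [leRHS](@big_cat_nat _ _ _ (h a + B ^ 2)%N) ?leq_addr//=.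
  by rewrite lerDl sumr_ge0.
rewrite /h -!mulnn; move: (B * B)%N => x; nia.
Qed.

(** Cauchy-Schwarz: the sum of [m^2 (m - la)^2] against the weights is nonnegative, and [la] is
    chosen to minimise it. *)
Lemma moment3_sqr_le (al : R) : 0 < al -> 0 < moment 2 al ->
  moment 3 al ^+ 2 <= moment 2 al * moment 4 al.
Proof.
move=> a0 m2; pose la := moment 3 al / moment 2 al.
have : 2 * la * moment 3 al <= moment 4 al + la ^+ 2 * moment 2 al.
  rewrite /moment -!tsumZ; try exact: summable_moment.
  rewrite -tsumD; [|exact: summable_moment|exact/summableZ/summable_moment].
  apply: le_tsum; last 2 first.
  - exact/summableZ/summable_moment.
  - by apply: summableD; [exact: summable_moment|exact/summableZ/summable_moment].
  move=> m; have c0 := coef_ge0 (R := R) S m.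
  have q0 : 0 <= expR (- al) ^+ m by rewrite exprn_ge0// expR_ge0.
  rewrite -subr_ge0 (_ : _ - _ = m%:R ^+ 2 * coef S m * expR (- al) ^+ m * (m%:R - la) ^+ 2).
    by apply: mulr_ge0; [exact: moment_term_ge0|exact: sqr_ge0].
  by move: (coef S m) (expR _ ^+ m) la => c q x; ring.
rewrite /la; move: (moment 2 al) (moment 3 al) (moment 4 al) m2 => x y z x0 h.
have : x * (2 * (y / x) * y) <= x * (z + (y / x) ^+ 2 * x) by rewrite ler_pM2l.
have -> : x * (2 * (y / x) * y) = 2 * y ^+ 2 by field; rewrite gt_eqF.
have -> : x * (z + (y / x) ^+ 2 * x) = x * z + y ^+ 2 by field; rewrite gt_eqF.
lra.
Qed.

(* [k^2] and [k^2 + h^2] both lie in S for every k, so [1 - cos (h^2 theta)] is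
   controlled by the sum of the terms at these two places. *)
Lemma weyl_lower_bound (al theta : R) (B h : nat) : 0 < al ->
  B%:R ^+ 4 * al <= 1 -> (h <= B ^ 2)%N ->
  B%:R ^+ 2 / 4 * expR (- 2) * (1 - cos ((h ^ 2)%:R * theta)) <=
  tsum (fun m => coef S m * expR (- al) ^+ m * (1 - cos (m%:R * theta))).
Proof.
move=> a0 Bal hB.
pose w m : R := coef S m * expR (- al) ^+ m * (1 - cos (m%:R * theta)).
have c1 m : 0 <= 1 - cos (m%:R * theta) :> R by rewrite subr_ge0 cos_le1.
have w0 m : 0 <= w m by rewrite !mulr_ge0 ?coef_ge0// exprn_ge0// expR_ge0.
have sw : abs_summable w.
  have s1 := @summable_coef R S _ (expRN_itv a0).
  have s2 : abs_summable (fun m => coef S m * expR (- al) ^+ m * cos (m%:R * theta)).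
    by apply: summable_coef_bdd => [|m]; [exact: expRN_itv|exact: abs_cos_le1].
  have := summableB s1 s2; congr abs_summable; apply/funext => m.
  by rewrite /w mulrBr mulr1.
have key l : (0 < l)%N -> S l -> l%:R * al <= 2 ->
    expR (- 2) * (1 - cos (l%:R * theta)) <= w l.
  move=> l0 lS la; rewrite /w ler_wpM2r// -[leLHS]mul1r; apply: ler_pM => //.
  - by rewrite ?expR_ge0 ?coef_ge1.
  - by rewrite -expRM_natr ler_expR mulNr lerN2 mulrC.
have B4 k : (k <= B ^ 2)%N -> (k ^ 2)%:R * al <= 1.
  move=> kB; apply: le_trans Bal; rewrite ler_wpM2r ?(ltW a0)// -natrX ler_nat.
  by rewrite (_ : B ^ 4 = (B ^ 2) ^ 2)%N ?leq_exp2r// -expnM.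
(* The two families may share indices, so each is bounded by the whole sum separately. This factor 2
   and the one in [one_sub_cos_diff] make up the denominator 4. *)
have h1 : \sum_(0 <= k < B ^ 2) w (k.+1 ^ 2)%N <= tsum w.
  by apply: (@sum_increasing_le_tsum _ w (fun k => k.+1 ^ 2)%N) => // k; rewrite ltn_exp2r.
have h2 : \sum_(0 <= k < B ^ 2) w (k.+1 ^ 2 + h ^ 2)%N <= tsum w.
  apply: (@sum_increasing_le_tsum _ w (fun k => k.+1 ^ 2 + h ^ 2)%N) => // k.
  by rewrite ltn_add2r ltn_exp2r.
have h3 : \sum_(0 <= k < B ^ 2) (expR (- 2) * (1 - cos ((h ^ 2)%:R * theta)) / 2) <=
    \sum_(0 <= k < B ^ 2) w (k.+1 ^ 2)%N + \sum_(0 <= k < B ^ 2) w (k.+1 ^ 2 + h ^ 2)%N.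
  rewrite -big_split/=; apply: ler_sum_nat => k /andP[_ kB].
  have k1 := B4 _ kB; have k2 := B4 _ hB.
  have e1 : expR (- 2) * (1 - cos ((k.+1 ^ 2)%:R * theta)) <= w (k.+1 ^ 2)%N.
    apply: key; [by rewrite expn_gt0| |lra].
    by have := @sum_sq_in_S k.+1 0 isT; rewrite exp0n// addn0.
  have e2 : expR (- 2) * (1 - cos ((k.+1 ^ 2 + h ^ 2)%:R * theta)) <= w (k.+1 ^ 2 + h ^ 2)%N.
    apply: key; [by rewrite addn_gt0 expn_gt0|exact: sum_sq_in_S|].
    by rewrite natrD; lra.
  have := one_sub_cos_diff ((k.+1 ^ 2 + h ^ 2)%:R * theta) ((k.+1 ^ 2)%:R * theta).
  have -> : (k.+1 ^ 2 + h ^ 2)%:R * theta - (k.+1 ^ 2)%:R * theta = (h ^ 2)%:R * theta.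
    by rewrite natrD mulrDl addrAC subrr add0r.
  have := expR_gt0 (- 2 : R); nra.
rewrite sumr_const_nat subn0 -[leLHS]mulr_natl [(B ^ 2)%:R]natrX in h3.
have -> : tsum (fun m => coef S m * expR (- al) ^+ m * (1 - cos (m%:R * theta))) = tsum w by [].
move: h3; set E := expR _ * _ => h3.
have -> : B%:R ^+ 2 / 4 * expR (- 2) * (1 - cos ((h ^ 2)%:R * theta)) = B%:R ^+ 2 * (E / 2) / 2.
  by rewrite /E; field.
lra.
Qed.

End Moments.

(** * Pointwise estimates on the circle *)

Section PointwiseEstimates.
Context {R : realType}.
Notation S := sums_of_two_squares.

Lemma sqr_abs (x : R) : `|x| ^+ 2 = x ^+ 2.
Proof. by rewrite real_normK ?num_real. Qed.

Lemma exp_mul_pow_le k (y : R) : 0 <= y -> y ^+ k * expR (- y) <= k%:R ^+ k.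
Proof.
move=> y0; have := pow_le_exp k y0.
by rewrite expRN ler_pdivrMr ?expR_gt0.
Qed.

(** In [y = t / 8] the polynomial is [4 y + 8 y^2 + (64/9) y^3]; against one factor [exp(- y)] it is
    at most [4 + 32 + 192 = 228]. *)
Lemma cubic_exp_le (t : R) : 0 <= t ->
  (t / 2 + t ^+ 2 / 8 + t ^+ 3 / 72) * expR (- t / 4) <= 300 * expR (- t / 8).
Proof.
move=> t0; pose y := t / 8; have y0 : 0 <= y by rewrite divr_ge0.
have -> : expR (- t / 4) = expR (- y) * expR (- t / 8).
  by rewrite -expRD /y; congr expR; field.
rewrite mulrA ler_wpM2r ?expR_ge0//.
have -> : t = 8 * y by rewrite /y; field.
have := exp_mul_pow_le 1 y0; have := exp_mul_pow_le 2 y0; have := exp_mul_pow_le 3 y0.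
rewrite !expr1; move: (expR (- y)) => e.
move=> h3 h2 h1.
have -> : (8 * y / 2 + (8 * y) ^+ 2 / 8 + (8 * y) ^+ 3 / 72) * e =
  4 * (y * e) + 8 * (y ^+ 2 * e) + 64 / 9 * (y ^+ 3 * e) by field.
lra.
Qed.

Lemma expR_sub_le (a b : R) : a <= b -> expR b - expR a <= (b - a) * expR b.
Proof.
move=> ab; have := expR_ge1Dx (a - b).
have -> : expR a = expR (a - b) * expR b by rewrite -expRD subrK.
have := expR_gt0 b; move: (expR b) (expR (a - b)) => e f e0 h; nra.
Qed.

(** The left side compares the real part of [exp(i w) (exp(- i th) - rho)], where [x = 1 - rho],
    with its value at [w = th = 0]. First-order terms in [w] and [th] are purely imaginary, so the
    error is quadratic. *)
Lemma cos_pair_le (w th x : R) : 0 <= x ->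
  `|cos (w - th) - (1 - x) * cos w - x| <= th ^+ 2 / 2 + `|w| * `|th| + x * w ^+ 2 / 2.
Proof.
move=> x0; rewrite cosB.
have -> : cos w * cos th + sin w * sin th - (1 - x) * cos w - x =
  - (cos w * (1 - cos th)) + sin w * sin th - x * (1 - cos w) by ring.
apply: le_trans (ler_normB _ _) _; apply: lerD; last first.
  rewrite normrM (ger0_norm x0) -mulrA ler_wpM2l// ger0_norm ?subr_ge0 ?cos_le1//.
  by have := cos_ge_taylor2 w; lra.
apply: le_trans (ler_normD _ _) _; apply: lerD; last first.
  by rewrite normrM ler_pM// sin_abs_le.
rewrite normrN normrM; have c0 : 0 <= 1 - cos th by rewrite subr_ge0 cos_le1.
rewrite (ger0_norm c0) -[leRHS]mul1r ler_pM// ?abs_cos_le1//.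
by have := cos_ge_taylor2 th; lra.
Qed.

Definition relerr (M2 Q x : R) : R := Q / M2 ^+ 2 + (M2 * x ^+ 2)^-1.

(** Here [d] is the drop of the logarithmic modulus, [w] the phase without its linear part and [T]
    the third moment. In the variable [t = th^2 M2] every error is [x * mu] times a power of [t];
    the condition on [th^2 Q] keeps [d >= t / 4], so that the exponential absorbs these powers. *)
Lemma major_arc (M2 T Q x th d w : R) :
  0 < M2 -> 0 <= T -> 0 <= Q -> T ^+ 2 <= M2 * Q -> 0 < x <= 1 ->
  `|w| <= `|th| ^+ 3 * T / 6 ->
  th ^+ 2 * M2 / 2 - th ^+ 4 * Q / 24 <= d -> d <= th ^+ 2 * M2 / 2 ->
  th ^+ 2 * Q <= 6 * M2 ->
  `|expR (- d) * (cos (w - th) - (1 - x) * cos w) - x * expR (- (th ^+ 2 * M2) / 2)|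
  <= 300 * x * relerr M2 Q x * expR (- (th ^+ 2 * M2) / 8).
Proof.
move=> M0 T0 Q0 TQ /andP[x0 x1] wT d1 d2 thQ.
set t := th ^+ 2 * M2; set mu := relerr M2 Q x.
have x0' := ltW x0; have M0' := ltW M0.
have Mn0 : M2 != 0 by rewrite gt_eqF.
have xn0 : x != 0 by rewrite gt_eqF.
have th0 : 0 <= th ^+ 2 by exact: sqr_ge0.
have t0 : 0 <= t by rewrite mulr_ge0// ltW.
have K0 : 0 <= Q / M2 ^+ 2 by rewrite divr_ge0// exprn_ge0// ltW.
have L0 : 0 <= (M2 * x ^+ 2)^-1 by rewrite invr_ge0 mulr_ge0 ?exprn_ge0// ltW.
have mu0 : 0 <= mu by rewrite addr_ge0.
have xmu0 : 0 <= x * mu by rewrite mulr_ge0// ltW.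
have dt : t / 4 <= d by rewrite /t; have := ler_wpM2l th0 thQ; nra.
have ed : expR (- d) <= expR (- t / 4) by rewrite ler_expR; lra.
have A1 : th ^+ 2 / 2 <= x * mu * (t / 2).
  have -> : th ^+ 2 / 2 = x * (x * (M2 * x ^+ 2)^-1) * (t / 2).
    by rewrite /t; field; rewrite xn0 Mn0.
  rewrite ler_wpM2r ?divr_ge0// ler_wpM2l//.
  apply: (@le_trans _ _ (M2 * x ^+ 2)^-1); first by rewrite ler_piMl.
  by rewrite lerDr.
have w2 : w ^+ 2 <= t ^+ 3 * mu / 36.
  rewrite -sqr_abs.
  apply: (@le_trans _ _ ((`|th| ^+ 3 * T / 6) ^+ 2)).
    by apply: lerXn2r; rewrite ?nnegrE// !mulr_ge0// exprn_ge0.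
  have -> : (`|th| ^+ 3 * T / 6) ^+ 2 = (th ^+ 2) ^+ 3 * T ^+ 2 / 36.
    by rewrite -(sqr_abs th); field.
  apply: (@le_trans _ _ ((th ^+ 2) ^+ 3 * (M2 * Q) / 36)).
    by rewrite ler_wpM2r// ler_wpM2l// exprn_ge0.
  have -> : (th ^+ 2) ^+ 3 * (M2 * Q) / 36 = t ^+ 3 * (Q / M2 ^+ 2) / 36.
    by rewrite /t; field.
  by rewrite ler_wpM2r// ler_wpM2l ?exprn_ge0// lerDl.
have A2 : `|w| * `|th| <= x * mu * (t ^+ 2 / 12).
  apply: (@le_trans _ _ (`|th| ^+ 3 * T / 6 * `|th|)); first by rewrite ler_wpM2r.
  have -> : `|th| ^+ 3 * T / 6 * `|th| = (th ^+ 2) ^+ 2 * T / 6.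
    by rewrite -(sqr_abs th); field.
  (* Arithmetic-geometric mean: [x Q + M2 / x >= 2 sqrt(M2 Q) >= 2 T]. This is where the two terms
     of [relerr] are combined. *)
  have TM : 2 * T / M2 ^+ 2 <= x * mu.
    have -> : x * mu = (x * Q + M2 / x) / M2 ^+ 2 by rewrite /mu /relerr; field; rewrite xn0 Mn0.
    rewrite ler_wpM2r ?invr_ge0 ?exprn_ge0//.
    have p0 : 0 <= x * Q + M2 / x by rewrite addr_ge0 ?mulr_ge0 ?invr_ge0.
    rewrite -(@ler_pXn2r _ 2)// ?nnegrE ?mulr_ge0//.
    have xy : x * Q * (M2 / x) = M2 * Q by field.
    move: (M2 / x) xy (sqr_ge0 (x * Q - M2 / x)) => y xy; nra.
  have -> : (th ^+ 2) ^+ 2 * T / 6 = 2 * T / M2 ^+ 2 * (t ^+ 2 / 12) by rewrite /t; field.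
  by rewrite ler_wpM2r// divr_ge0// exprn_ge0.
have A3 : x * w ^+ 2 / 2 <= x * mu * (t ^+ 3 / 72).
  have -> : x * mu * (t ^+ 3 / 72) = x * (t ^+ 3 * mu / 36) / 2 by field.
  by rewrite ler_wpM2r// ler_wpM2l.
have A4 : `|expR (- d) - expR (- t / 2)| <= mu * (t ^+ 2 / 24) * expR (- t / 4).
  rewrite ger0_norm; last by rewrite subr_ge0 ler_expR /t; lra.
  apply: le_trans (expR_sub_le _) _; first by rewrite /t; lra.
  apply: ler_pM => //; first by rewrite /t; lra.
  apply: (@le_trans _ _ (th ^+ 4 * Q / 24)); first by rewrite /t; lra.
  have -> : th ^+ 4 * Q / 24 = (Q / M2 ^+ 2) * (t ^+ 2 / 24) by rewrite /t; field.
  by rewrite ler_wpM2r ?divr_ge0 ?exprn_ge0// lerDl.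
set g := cos (w - th) - (1 - x) * cos w.
have -> : expR (- d) * g - x * expR (- t / 2) =
  expR (- d) * (g - x) + x * (expR (- d) - expR (- t / 2)) by ring.
apply: le_trans (ler_normD _ _) _.
apply: (@le_trans _ _ (x * mu * ((t / 2 + t ^+ 2 / 8 + t ^+ 3 / 72) * expR (- t / 4)))); last first.
  have -> : 300 * x * mu * expR (- t / 8) = x * mu * (300 * expR (- t / 8)) by ring.
  by rewrite ler_wpM2l// cubic_exp_le.
have -> : x * mu * ((t / 2 + t ^+ 2 / 8 + t ^+ 3 / 72) * expR (- t / 4)) =
  expR (- t / 4) * (x * mu * (t / 2) + x * mu * (t ^+ 2 / 12) + x * mu * (t ^+ 3 / 72)) +
  x * (mu * (t ^+ 2 / 24) * expR (- t / 4)) by field.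
apply: lerD; last by rewrite normrM (gtr0_norm x0) ler_wpM2l.
rewrite normrM (ger0_norm (expR_ge0 _)); apply: ler_pM => //.
apply: le_trans (cos_pair_le _ _ (ltW x0)) _.
by rewrite lerD// lerD.
Qed.

(** * Taylor bounds for modulus and phase on the circle *)

Section Arc.
Variables (al : R).
Hypothesis al0 : 0 < al.
Let rho := expR (- al).
Let U th := tsum (fun m => coef S m * rho ^+ m * cos (m%:R * th)).
Let V th := tsum (fun m => coef S m * rho ^+ m * sin (m%:R * th)).
Let D th := tsum (fun m => coef S m * rho ^+ m * (1 - cos (m%:R * th))).

Let sU th : abs_summable (fun m => coef S m * rho ^+ m * cos (m%:R * th)).
Proof. by apply: summable_coef_bdd => [|m]; [exact: expRN_itv|exact: abs_cos_le1]. Qed.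

Let sV th : abs_summable (fun m => coef S m * rho ^+ m * sin (m%:R * th)).
Proof. by apply: summable_coef_bdd => [|m]; [exact: expRN_itv|exact: abs_sin_le1]. Qed.

Let sc : abs_summable (fun m => coef S m * rho ^+ m).
Proof. by apply: summable_coef; exact: expRN_itv. Qed.

Let cr0 m : 0 <= coef S m * rho ^+ m.
Proof. by rewrite mulr_ge0 ?coef_ge0// exprn_ge0// expR_ge0. Qed.

Lemma log_modulus_drop th :
  tsum (fun m => coef S m * rho ^+ m) - U th = D th.
Proof. by rewrite -tsumB//; apply: eq_tsum => m; rewrite mulrBr mulr1. Qed.

Let sD th : abs_summable (fun m => coef S m * rho ^+ m * (1 - cos (m%:R * th))).
Proof.
have := summableB sc (@sU th); congr abs_summable; apply/funext => m.
by rewrite mulrBr mulr1.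
Qed.

Lemma drop_le th : D th <= th ^+ 2 * moment 2 al / 2.
Proof.
rewrite mulrAC -tsumZ; last exact: summable_moment.
apply: le_tsum => //; last exact/summableZ/summable_moment.
move=> m; rewrite -/rho.
have -> : th ^+ 2 / 2 * (m%:R ^+ 2 * coef S m * rho ^+ m) =
  coef S m * rho ^+ m * ((m%:R * th) ^+ 2 / 2) by move: (coef S m) (rho ^+ m) => c q; field.
by rewrite ler_wpM2l//; have := cos_ge_taylor2 (m%:R * th); lra.
Qed.

Lemma drop_ge th :
  th ^+ 2 * moment 2 al / 2 - th ^+ 4 * moment 4 al / 24 <= D th.
Proof.
rewrite mulrAC (mulrAC (th ^+ 4)) -!tsumZ; try exact: summable_moment.
rewrite -tsumB; try exact/summableZ/summable_moment.
apply: le_tsum => //; last by apply: summableB; exact/summableZ/summable_moment.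
move=> m; rewrite -/rho.
have -> : th ^+ 2 / 2 * (m%:R ^+ 2 * coef S m * rho ^+ m) -
    th ^+ 4 / 24 * (m%:R ^+ 4 * coef S m * rho ^+ m) =
  coef S m * rho ^+ m * ((m%:R * th) ^+ 2 / 2 - (m%:R * th) ^+ 4 / 24).
  by move: (coef S m) (rho ^+ m) => c q; field.
by rewrite ler_wpM2l//; have := cos_le_taylor4 (m%:R * th); lra.
Qed.

Lemma phase_le th : `|V th - moment 1 al * th| <= `|th| ^+ 3 * moment 3 al / 6.
Proof.
rewrite (mulrC (moment 1 al)) mulrAC -!tsumZ; try exact: summable_moment.
rewrite -tsumB//; last exact/summableZ/summable_moment.
apply: le_norm_tsum; last exact/summableZ/summable_moment.
move=> m; rewrite -/rho.
have -> : coef S m * rho ^+ m * sin (m%:R * th) - th * (m%:R ^+ 1 * coef S m * rho ^+ m) =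
  coef S m * rho ^+ m * (sin (m%:R * th) - m%:R * th) by rewrite expr1; ring.
have -> : `|th| ^+ 3 / 6 * (m%:R ^+ 3 * coef S m * rho ^+ m) =
  coef S m * rho ^+ m * (`|m%:R * th| ^+ 3 / 6).
  by rewrite normrM (ger0_norm (ler0n _ m)); move: (coef S m) (rho ^+ m) => c q; field.
by rewrite normrM (ger0_norm (cr0 m)) ler_wpM2l// sin_sub_id_le.
Qed.

End Arc.
End PointwiseEstimates.

(** * Decay on the minor arc and size of the relative error *)

Section MinorArc.
Context {R : realType}.
Notation S := sums_of_two_squares.

(** From [1 <= 16 B^4 al] one gets [al^(-5) <= 16^5 B^20]. *)
Definition quartic_pow_const : R := quartic_const * 16 ^+ 5.
Let K0 := quartic_pow_const.

Lemma quartic_pow_const_ge16 : 16 <= K0.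
Proof.
rewrite /K0 /quartic_pow_const -[leLHS]mul1r; apply: ler_pM => //.
  exact: quartic_const_ge1.
by rewrite exprS -[leLHS]mulr1 ler_wpM2l// exprn_ege1// ler1n.
Qed.

Let K0_gt0 : 0 < K0. Proof. by have := quartic_pow_const_ge16; lra. Qed.

Lemma moment4_le_pow (al : R) (B : nat) : 0 < al -> 1 <= 16 * (B%:R ^+ 4 * al) ->
  moment 4 al <= quartic_pow_const * B%:R ^+ 20.
Proof.
move=> a0 Bal; apply: le_trans (moment4_le a0) _; rewrite -/K0.
rewrite ler_pdivrMr ?exprn_gt0//.
have -> : K0 * B%:R ^+ 20 * al ^+ 5 = quartic_const * (16 * (B%:R ^+ 4 * al)) ^+ 5.
  by rewrite /K0 /quartic_pow_const; move: (B%:R : R) => b; ring.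
rewrite -[leLHS]mulr1 ler_wpM2l ?exprn_ege1//.
by have := @quartic_const_ge1 R; lra.
Qed.

(** Take the largest [h <= B^2] with [h^2 |th| <= 1]. If the cap is not reached, maximality gives
    [h^2 |th| >= 1/4] and a bound of order [B^2]. If [h = B^2], the moment bounds give
    [th^2 >= c1 B^(-9)], so [(B^4 th)^2] is at least of order [1 / B]; this critical case leaves
    only [c B]. *)
Lemma minor_arc : exists2 c : R, 0 < c & forall (al th : R) (B : nat),
  0 < al -> (0 < B)%N -> B%:R ^+ 4 * al <= 1 -> 1 <= 16 * (B%:R ^+ 4 * al) ->
  `|th| <= pi -> 6 * moment 2 al <= th ^+ 2 * moment 4 al ->
  c * B%:R <= tsum (fun m => coef S m * expR (- al) ^+ m * (1 - cos (m%:R * th))).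
Proof.
have K00 := K0_gt0; have e50 : 0 < expR (- 5) :> R := expR_gt0 _.
have [c1 c10 [c11 c1E]] : exists2 c1 : R, 0 < c1 & c1 <= 1 /\ 6 * expR (- 5) = K0 * c1.
  exists (6 * expR (- 5) / K0); first by apply: divr_gt0 => //; lra.
  have Kn0 : K0 != 0 by rewrite gt_eqF.
  split; last by rewrite [RHS]mulrC divfK.
  rewrite ler_pdivrMr// mul1r.
  have e1 : expR (- 5) <= 1 :> R by rewrite -[leRHS]expR0 ler_expR; lra.
  by have := quartic_pow_const_ge16; lra.
have [e2 e20 e2E] : exists2 e2 : R, 0 < e2 & expR (- 2) = e2.
  by exists (expR (- 2)) => //; exact: expR_gt0.
have ec0 := mulr_gt0 e20 c10.
exists (e2 * c1 / 1000); first by lra.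
move=> al th B a0 B0 Bal1 Bal2 thpi thM.
have b1 : 1 <= B%:R :> R by rewrite ler1n.
have W h := @weyl_lower_bound R al `|th| B h a0 Bal1.
have cabs (y : R) : cos (y * `|th|) = cos (y * th).
  have [_|_] := ger0P th; first by [].
  by rewrite mulrN cosN.
have DE : tsum (fun m => coef S m * expR (- al) ^+ m * (1 - cos (m%:R * th))) =
    tsum (fun m => coef S m * expR (- al) ^+ m * (1 - cos (m%:R * `|th|))).
  by apply: eq_tsum => m; rewrite cabs.
rewrite DE.
(* The threshold [c1 / 250] lies below the values 1/4, [c1 / 4] and 1/64 reached in the three
   cases. *)
have fin h z : (h <= B ^ 2)%N -> z <= 1 - cos ((h ^ 2)%:R * `|th|) ->
    c1 / 250 <= z * B%:R ->
    e2 * c1 / 1000 * B%:R <= tsum (fun m => coef S m * expR (- al) ^+ m * (1 - cos (m%:R * `|th|))).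
  move=> hB zh zB; apply: le_trans (W h hB).
  have q0 : 0 <= B%:R / 4 * e2 by rewrite mulr_ge0 ?divr_ge0// ltW.
  apply: (@le_trans _ _ (B%:R / 4 * e2 * (z * B%:R))).
    have -> : e2 * c1 / 1000 * B%:R = B%:R / 4 * e2 * (c1 / 250) by field.
    exact: ler_wpM2l.
  have -> : B%:R ^+ 2 / 4 * expR (- 2) * (1 - cos ((h ^ 2)%:R * `|th|)) =
    B%:R / 4 * e2 * ((1 - cos ((h ^ 2)%:R * `|th|)) * B%:R).
    by rewrite e2E; field.
  by rewrite ler_wpM2l// ler_wpM2r.
have t0 : 0 <= `|th| by [].
have small (y : R) : 0 <= y <= 1 -> y ^+ 2 / 4 <= 1 - cos y.
  move=> /andP[y0 y1]; have := cos_le_taylor4 y.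
  have : y ^+ 4 <= y ^+ 2 by rewrite ler_wiXn2l.
  nra.
have [th1|th1] := leP 1 `|th|.
  apply: (fin 1%N (1 / 4)); first by rewrite expn_gt0 B0.
    rewrite exp1n [1%:R * _]mul1r.
    have : cos `|th| <= cos 1.
      move: th1; rewrite le_eqVlt => /orP[/eqP<-//|th1]; apply: ltW.
      rewrite ltr_cos ?in_itv//= ?t0//= ler01/=.
      by have := @pi_ge2 R; lra.
    have := @small 1; rewrite ler01 lexx expr1n => /(_ isT); lra.
  nra.
have exP : exists h : nat, (h <= B ^ 2)%N && ((h ^ 2)%:R * `|th| <= 1) by exists 0%N; rewrite exp0n// mul0r ler01.
have ubP h : (h <= B ^ 2)%N && ((h ^ 2)%:R * `|th| <= 1) -> (h <= B ^ 2)%N by case/andP.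
have [h /andP[hB hth] hmax] := ex_maxnP exP ubP.
have y0 : 0 <= (h ^ 2)%:R * `|th| by rewrite mulr_ge0.
apply: (fin h (((h ^ 2)%:R * `|th|) ^+ 2 / 4)) => //.
  by apply: small; rewrite y0.
have [hE|hlt] := eqVneq h (B ^ 2)%N.
  have M2 := moment2_ge a0 B0 Bal1; have M4 : moment 4 al <= K0 * _ := moment4_le_pow a0 Bal2.
  have t2 : 0 <= th ^+ 2 by exact: sqr_ge0.
  have : 6 * (B%:R ^+ 11 * expR (- 5)) <= th ^+ 2 * (K0 * B%:R ^+ 20).
    by apply: le_trans (le_trans thM _); [rewrite ler_wpM2l|rewrite ler_wpM2l].
  have b11 : 0 < B%:R ^+ 11 :> R by rewrite exprn_gt0// (lt_le_trans ltr01).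
  have -> : 6 * (B%:R ^+ 11 * expR (- 5)) = B%:R ^+ 11 * (K0 * c1).
    by rewrite -c1E; ring.
  have -> : th ^+ 2 * (K0 * B%:R ^+ 20) = B%:R ^+ 11 * (K0 * (th ^+ 2 * B%:R ^+ 9)).
    by move: (B%:R : R) => b; ring.
  rewrite ler_pM2l// ler_pM2l// => h9.
  rewrite hE natrX natrX.
  have -> : ((B%:R ^+ 2) ^+ 2 * `|th|) ^+ 2 / 4 * B%:R = th ^+ 2 * B%:R ^+ 9 / 4.
    by rewrite -(sqr_abs th); field.
  lra.
have hB' : (h < B ^ 2)%N by rewrite ltn_neqAle hlt.
have h1 : (0 < h)%N.
  by apply: hmax; rewrite expn_gt0 B0/= exp1n mul1r ltW.
have : 1 < (h.+1 ^ 2)%:R * `|th|.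
  by rewrite ltNge; apply/negP => le1; have := hmax h.+1; rewrite hB' le1 ltnn => /(_ isT).
have : (h.+1 ^ 2)%:R <= 4 * (h ^ 2)%:R :> R.
  rewrite -(natrM _ 4) ler_nat -[4%N]/(2 ^ 2)%N -expnMn leq_exp2r//.
  by rewrite mul2n -addnn -addn1 leq_add2l.
move: ((h ^ 2)%:R : R) ((h.+1 ^ 2)%:R : R) y0 => u v y0 uv vt.
have : 1 / 4 <= u * `|th| by nra.
move: (u * `|th|) => y yy; have : 1 / 16 <= y ^+ 2 by nra.
nra.
Qed.

Lemma one_sub_expN_ge (al : R) : 0 < al <= 1 -> al / 2 <= 1 - expR (- al).
Proof.
move=> /andP[a0 a1]; have := expR_ge1Dx al; rewrite expRN => h.
have q0 : 0 < expR al := expR_gt0 _.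
have : (expR al)^-1 <= (1 + al)^-1 by rewrite lef_pV2 ?posrE//; lra.
have : (1 + al)^-1 <= 1 - al / 2.
  by rewrite -[leLHS]mul1r ler_pdivrMr; nra.
lra.
Qed.

Definition Krel : R := quartic_pow_const * expR 10 + 1024 * expR 5.

(** Up to constants the first term is [B^20 / B^22] and the second [B^8 / B^11], so the fourth
    moment decides. The factor 1024 is [4 * 16^2], from [(al / 2)^2]. *)
Lemma relerr_le (al : R) (B : nat) : 0 < al <= 1 -> (0 < B)%N ->
  B%:R ^+ 4 * al <= 1 -> 1 <= 16 * (B%:R ^+ 4 * al) ->
  relerr (moment 2 al) (moment 4 al) (1 - expR (- al)) <= Krel / B%:R ^+ 2.
Proof.
move=> /andP[a0 a1] B0 Bal1 Bal2.
have M2 := moment2_ge a0 B0 Bal1; have M4 : moment 4 al <= K0 * _ := moment4_le_pow a0 Bal2.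
have b1 : 1 <= B%:R :> R by rewrite ler1n.
have b0 : 0 < B%:R :> R by rewrite (lt_le_trans ltr01).
have bn0 : B%:R != 0 :> R by rewrite gt_eqF.
have e0 : 0 < expR (- 5) :> R := expR_gt0 _.
have p11 : 0 < B%:R ^+ 11 * expR (- 5) :> R by rewrite mulr_gt0// exprn_gt0.
have M20 : 0 < moment 2 al := lt_le_trans p11 M2.
have K00 := K0_gt0.
rewrite /relerr /Krel -/K0 mulrDl; apply: lerD.
  rewrite ler_pdivrMr ?exprn_gt0//.
  apply: le_trans M4 _.
  have sq : (B%:R ^+ 11 * expR (- 5)) ^+ 2 <= moment 2 al ^+ 2.
    by apply: lerXn2r => //; rewrite nnegrE ltW.
  have ke : 0 <= K0 * expR 10 / B%:R ^+ 2 by rewrite divr_ge0 ?exprn_ge0// mulr_ge0 ?expR_ge0// ltW.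
  apply: le_trans (ler_wpM2l ke sq).
  have -> : expR 10 = (expR (- 5) ^+ 2)^-1 :> R.
    by rewrite -expRM_natr -expRN; congr expR; ring.
  by rewrite le_eqVlt; apply/orP; left; apply/eqP; field; rewrite bn0 gt_eqF.
have x2 : al / 2 <= 1 - expR (- al) by apply: one_sub_expN_ge; rewrite a0.
have x0 : 0 < 1 - expR (- al) by apply: lt_le_trans x2; rewrite divr_gt0.
have low : B%:R ^+ 11 * expR (- 5) * (al / 2) ^+ 2 <= moment 2 al * (1 - expR (- al)) ^+ 2.
  have p110 := ltW p11.
  apply: ler_pM => //; first exact: sqr_ge0.
  by apply: lerXn2r => //; rewrite nnegrE ltW// divr_gt0.
have low0 : 0 < B%:R ^+ 11 * expR (- 5) * (al / 2) ^+ 2.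
  by rewrite mulr_gt0// exprn_gt0// divr_gt0.
apply: (@le_trans _ _ (B%:R ^+ 11 * expR (- 5) * (al / 2) ^+ 2)^-1).
  by rewrite lef_pV2// ?posrE// mulr_gt0// exprn_gt0.
have -> : expR 5 = (expR (- 5))^-1 :> R by rewrite -expRN opprK.
rewrite -[leLHS]mul1r ler_pdivrMr//.
have -> : 1024 * (expR (- 5))^-1 / B%:R ^+ 2 * (B%:R ^+ 11 * expR (- 5) * (al / 2) ^+ 2) =
   B%:R * (16 * (B%:R ^+ 4 * al)) ^+ 2.
  by field; rewrite bn0 gt_eqF.
rewrite -[leLHS]mulr1; apply: ler_pM => //; exact: exprn_ege1.
Qed.

End MinorArc.

(** * Gaussian and trigonometric integrals *)

Section Integrals.
Context {R : realType}.
Local Notation mu := (@lebesgue_measure R).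

Let I : set R := `[- pi, pi]%classic.

Lemma lebesgue_pi_itv : fine (@lebesgue_measure R I) = 2 * pi.
Proof.
have pip := @pi_gt0 R.
rewrite /I lebesgue_measure_itv/= lte_fin ifT; last by lra.
by rewrite /= opprK; ring.
Qed.

(** A multiple of the normal density with variance [1 / a], whose total mass is 1. *)
Lemma gauss_integral (a : R) : 0 < a ->
  mu.-integrable setT (EFin \o (fun x : R => expR (- (x ^+ 2 * a) / 2))) /\
  \int[mu]_x expR (- (x ^+ 2 * a) / 2) = Num.sqrt (2 * pi / a).
Proof.
move=> a0; pose s := (Num.sqrt a)^-1.
have sa0 : 0 < Num.sqrt a by rewrite sqrtr_gt0.
have s0 : s != 0 by rewrite invr_eq0 gt_eqF.
have s2 : s ^+ 2 = a^-1 by rewrite /s exprVn sqr_sqrtr// ltW.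
have pk : normal_peak s = (Num.sqrt (2 * pi / a))^-1.
  rewrite /normal_peak s2; congr (_^-1); congr (Num.sqrt _).
  by rewrite -mulr_natl; ring.
have r0 : 0 < Num.sqrt (2 * pi / a).
  by rewrite sqrtr_gt0 divr_gt0// mulr_gt0// pi_gt0.
have E : (fun x : R => expR (- (x ^+ 2 * a) / 2)) =
    (fun x => Num.sqrt (2 * pi / a) * normal_pdf 0 s x).
  apply/funext => x; rewrite normal_pdfE// pk mulrA mulfV ?gt_eqF// mul1r.
  rewrite /normal_fun subr0 s2; congr expR; rewrite -mulr_natl; field.
  by rewrite gt_eqF.
have ip := @integrable_normal_pdf R 0 s.
rewrite E; split.
  have := integrableZl measurableT (Num.sqrt (2 * pi / a)) ip.
  by apply: eq_integrable => // x _; rewrite /= EFinM.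
rewrite RintegralZl//.
by rewrite /Rintegral integral_normal_pdf/= mulr1.
Qed.

Lemma continuous_integrable_pi (f : R -> R) : continuous f ->
  mu.-integrable I (EFin \o f).
Proof.
move=> cf; apply: continuous_compact_integrable; first exact: segment_compact.
exact: continuous_subspaceT.
Qed.

Lemma sin_nat_mul_pi (n : nat) : sin (n%:R * pi) = 0 :> R.
Proof.
elim: n => [|n IH]; first by rewrite mul0r sin0.
by rewrite -natr1 mulrDl mul1r sinDpi IH oppr0.
Qed.

Lemma continuous_cos_scaled (c : R) : continuous (fun t : R => cos (c * t)).
Proof.
move=> t; apply: (@continuous_comp _ _ _ ( *%R c) cos); last exact: continuous_cos.
exact: mulrl_continuous.
Qed.

Lemma integral_cos_nat_sub (m N : nat) :
  \int[mu]_(t in I) cos ((m%:R - N%:R) * t) = if m == N then 2 * pi else 0.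
Proof.
have pip := @pi_gt0 R; case: eqVneq => [->|mN].
  under eq_Rintegral do rewrite subrr mul0r cos0.
  rewrite Rintegral_cst; last exact: measurable_itv.
  by rewrite mul1r; exact: lebesgue_pi_itv.
set c : R := m%:R - N%:R.
have c0 : c != 0 by rewrite subr_eq0 eqr_nat.
have Fd (t : R) : is_derive t 1 (fun t => c^-1 * sin (c * t)) (cos (c * t)).
  have cd : is_derive t 1 (fun t : R => c * t) c.
    by apply: is_derive_eq; rewrite /GRing.scale/= mulr1.
  have sd : is_derive t 1 (fun t => sin (c * t)) (cos (c * t) * c).
    exact: (is_derive1_comp (is_derive_sin (c * t)) cd).
  apply: is_derive_eq; rewrite /GRing.scale/=.
  by rewrite mulrCA mulVf// mulr1.
have s0 : sin (c * pi) = 0.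
  by rewrite mulrBl sinB !sin_nat_mul_pi mul0r mulr0 subrr.
have cF : continuous (fun t : R => c^-1 * sin (c * t)).
  move=> t; apply: differentiable_continuous; apply/derivable1_diffP.
  by have := Fd t; move=> [].
rewrite /Rintegral (@continuous_FTC2 _ _ (fun t => c^-1 * sin (c * t))).
- by rewrite mulrN sinN s0 oppr0 !mulr0 /= subrr.
- lra.
- exact/continuous_subspaceT/continuous_cos_scaled.
- split.
  + by move=> t _; have := Fd t; move=> [].
  + exact/cvg_at_right_filter/cF.
  + exact/cvg_at_left_filter/cF.
- by move=> t _; rewrite derive1E; have := Fd t; move=> [].
Qed.

(** The real part of [exp(- i (n+1) t) (1 - rho exp(i t)) sum c_m exp(i m t)]; its mean over the
    circle is the coefficient of index [n+1] of the product. *)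
Definition cos_poly (c : nat -> R) (rho : R) (n M : nat) (t : R) : R :=
  \sum_(0 <= m < M) c m * (cos ((m%:R - n.+1%:R) * t) - rho * cos ((m.+1%:R - n.+1%:R) * t)).

Lemma continuous_cos_poly c rho n M : continuous (cos_poly c rho n M).
Proof.
elim: M => [|M IH] t.
  rewrite (_ : cos_poly _ _ _ _ = cst 0); first exact: cvg_cst.
  by apply/funext => u; rewrite /cos_poly big_geq.
rewrite (_ : cos_poly _ _ _ M.+1 = fun t => cos_poly c rho n M t +
  c M * (cos ((M%:R - n.+1%:R) * t) - rho * cos ((M.+1%:R - n.+1%:R) * t))); last first.
  by apply/funext => u; rewrite /cos_poly big_nat_recr.
apply: cvgD; first exact: IH.
apply: cvgM; first exact: cvg_cst.
apply: cvgB; first exact: continuous_cos_scaled.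
apply: cvgM; first exact: cvg_cst.
exact: continuous_cos_scaled.
Qed.

Lemma integral_cos_poly c rho n M : (n.+1 < M)%N ->
  \int[mu]_(t in I) cos_poly c rho n M t = 2 * pi * (c n.+1 - rho * c n).
Proof.
have mI : measurable I by exact: measurable_itv.
have ic k := continuous_integrable_pi (@continuous_cos_scaled k).
have step K : \int[mu]_(t in I) cos_poly c rho n K t =
    \sum_(0 <= m < K) c m * ((if m == n.+1 then 2 * pi else 0) -
                             rho * (if m == n then 2 * pi else 0)).
  elim: K => [|K IH].
    rewrite big_geq//; under eq_Rintegral do rewrite /cos_poly big_geq//.
    by rewrite Rintegral_cst// mul0r.
  rewrite big_nat_recr//= -IH.
  have -> : \int[mu]_(t in I) cos_poly c rho n K.+1 t = \int[mu]_(t in I)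
      (cos_poly c rho n K t + c K * (cos ((K%:R - n.+1%:R) * t) -
         rho * cos ((K.+1%:R - n.+1%:R) * t))).
    by apply: eq_Rintegral => t _; rewrite /cos_poly big_nat_recr.
  have i0 : mu.-integrable I (EFin \o (fun t => cos ((K%:R - n.+1%:R) * t))) := ic _.
  have i1 : mu.-integrable I (EFin \o (fun t => cos ((K.+1%:R - n.+1%:R) * t))) := ic _.
  have i2 : mu.-integrable I (EFin \o (fun t => rho * cos ((K.+1%:R - n.+1%:R) * t))).
    apply: continuous_integrable_pi => t.
    by apply: cvgM; [exact: cvg_cst|exact: continuous_cos_scaled].
  have i3 : mu.-integrable I (EFin \o (fun t => cos ((K%:R - n.+1%:R) * t) -
      rho * cos ((K.+1%:R - n.+1%:R) * t))).
    apply: continuous_integrable_pi => t; apply: cvgB; first exact: continuous_cos_scaled.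
    by apply: cvgM; [exact: cvg_cst|exact: continuous_cos_scaled].
  have i4 : mu.-integrable I (EFin \o (fun t => c K * (cos ((K%:R - n.+1%:R) * t) -
      rho * cos ((K.+1%:R - n.+1%:R) * t)))).
    apply: continuous_integrable_pi => t; apply: cvgM; first exact: cvg_cst.
    apply: cvgB; first exact: continuous_cos_scaled.
    by apply: cvgM; [exact: cvg_cst|exact: continuous_cos_scaled].
  rewrite RintegralD//; last exact/continuous_integrable_pi/continuous_cos_poly.
  congr (_ + _); rewrite RintegralZl// RintegralB//.
  rewrite RintegralZl//.
  by rewrite !integral_cos_nat_sub eqSS.
move=> nM; rewrite step.
rewrite (eq_bigr (fun m => (if m == n.+1 then 2 * pi * c n.+1 else 0) +
  (if m == n then - (2 * pi * (rho * c n)) else 0))); last first.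
  move=> m _; case: (eqVneq m n.+1) => [->|_]; last first.
    by case: (eqVneq m n) => [->|_]; ring.
  by rewrite gtn_eqF//; ring.
rewrite big_split/= !big_mkord.
have nM' : (n < M)%N by exact: ltnW.
rewrite (bigD1 (Ordinal nM))//= eqxx big1 ?addr0; last first.
  by move=> i /negPf; rewrite -val_eqE /= => ->.
rewrite (bigD1 (Ordinal nM'))//= eqxx big1 ?addr0; last first.
  by move=> i /negPf; rewrite -val_eqE /= => ->.
ring.
Qed.

(** [G] is extended by zero to the line, so the Gaussian tail is controlled by one more pointwise
    hypothesis. The Gaussian with exponent divided by 4 has twice the integral. *)
Lemma integral_near_gauss (G : R -> R) (a x E1 E2 : R) : continuous G -> 0 < a ->
  (forall t, `|t| <= pi -> `|G t - x * expR (- (t ^+ 2 * a) / 2)| <=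
     E1 * expR (- (t ^+ 2 * a) / 8) + E2) ->
  (forall t, pi < `|t| -> `|x * expR (- (t ^+ 2 * a) / 2)| <=
     E1 * expR (- (t ^+ 2 * a) / 8)) ->
  `|\int[mu]_(t in I) G t - x * Num.sqrt (2 * pi / a)| <=
  E1 * (2 * Num.sqrt (2 * pi / a)) + 2 * pi * E2.
Proof.
move=> cG a0 in_le out_le.
have pip := @pi_gt0 R.
have mI : measurable I by exact: measurable_itv.
have [ig gE] := gauss_integral a0.
have a40 : 0 < a / 4 by rewrite divr_gt0.
have [ig8 g8E] := gauss_integral a40.
have e8 : (fun t : R => expR (- (t ^+ 2 * (a / 4)) / 2)) = (fun t => expR (- (t ^+ 2 * a) / 8)).
  by apply/funext => t; congr expR; field.
rewrite e8 in ig8 g8E.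
have sq8 : Num.sqrt (2 * pi / (a / 4)) = 2 * Num.sqrt (2 * pi / a).
  rewrite (_ : 2 * pi / (a / 4) = 2 ^+ 2 * (2 * pi / a)); last by field; rewrite gt_eqF.
  by rewrite sqrtrM ?sqr_ge0// sqrtr_sqr ger0_norm.
rewrite sq8 in g8E.
pose h t := (G \_ I) t - x * expR (- (t ^+ 2 * a) / 2).
have iG : mu.-integrable setT (EFin \o (G \_ I)).
  rewrite -restrict_EFin; apply: (iffLR (integrable_mkcond _ _)); first exact: measurable_itv.
  exact: continuous_integrable_pi.
have ixg : mu.-integrable setT (EFin \o (fun t : R => x * expR (- (t ^+ 2 * a) / 2))).
  have := integrableZl measurableT x ig.
  by apply: eq_integrable => // t _; rewrite /= EFinM.
have ih : mu.-integrable setT (EFin \o h).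
  have := integrableB measurableT iG ixg.
  by apply: eq_integrable => // t _; rewrite /= EFinB.
have iE1 : mu.-integrable setT (EFin \o (fun t : R => E1 * expR (- (t ^+ 2 * a) / 8))).
  have := integrableZl measurableT E1 ig8.
  by apply: eq_integrable => // t _; rewrite /= EFinM.
have iE2 : mu.-integrable setT (EFin \o ((cst E2) \_ I)).
  rewrite -restrict_EFin; apply: (iffLR (integrable_mkcond _ _)); first exact: measurable_itv.
  by apply: continuous_integrable_pi; exact: cst_continuous.
have iE : mu.-integrable setT (EFin \o (fun t : R => E1 * expR (- (t ^+ 2 * a) / 8) + ((cst E2) \_ I) t)).
  have := integrableD measurableT iE1 iE2.
  by apply: eq_integrable => // t _; rewrite /= EFinD.
have hE : \int[mu]_t h t = \int[mu]_(t in I) G t - x * Num.sqrt (2 * pi / a).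
  by rewrite RintegralB// RintegralZl// gE -Rintegral_mkcond.
rewrite -hE; apply: le_trans (le_normr_Rintegral measurableT ih) _.
have -> : E1 * (2 * Num.sqrt (2 * pi / a)) + 2 * pi * E2 =
    \int[mu]_t (E1 * expR (- (t ^+ 2 * a) / 8) + ((cst E2) \_ I) t).
  rewrite RintegralD// RintegralZl// g8E -Rintegral_mkcond Rintegral_cst//.
  by rewrite [fine _](_ : _ = 2 * pi) 1?(mulrC E2)//; exact: lebesgue_pi_itv.
apply: le_Rintegral => //.
  exact: integrable_norm.
move=> t _; rewrite /h /patch.
have tI : (t \in I) = (`|t| <= pi).
  by rewrite /I; apply/idP/idP; rewrite inE /= in_itv/= ler_norml.
rewrite tI; case: ifPn => ht; first exact: in_le.
by rewrite sub0r normrN addr0; apply: out_le; rewrite ltNge.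
Qed.

End Integrals.

(** * The saddle point *)

Section SaddlePoint.
Context {R : realType}.
Notation S := sums_of_two_squares.

(** Away from the centre the Gaussian itself counts as error: one factor [exp(- T / 4)] is at most
    [mu], because [1 <= mu T / 4 <= mu exp(T / 4)]. *)
Lemma gauss_tail_le (mu T : R) : 0 < T -> 4 <= mu * T ->
  expR (- T / 2) <= mu * expR (- T / 8).
Proof.
move=> T0 muT.
have -> : expR (- T / 2) = expR (- T / 4) * expR (- T / 4).
  by rewrite -expRD; congr expR; field.
apply: ler_pM; rewrite ?expR_ge0//; last by rewrite ler_expR; lra.
rewrite mulNr expRN -[leLHS]mul1r ler_pdivrMr ?expR_gt0//.
apply: (@le_trans _ _ (mu * (T / 4))); first by lra.
apply: ler_wpM2l; last by have := expR_ge1Dx (T / 4); lra.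
by rewrite -(pmulr_lge0 _ T0); lra.
Qed.

Lemma moment2_le_moment4 (al : R) : 0 < al -> moment 2 al <= moment 4 al.
Proof.
move=> a0; apply: le_tsum; [|exact: summable_moment|exact: summable_moment].
move=> m; rewrite !ler_wpM2r ?coef_ge0 ?exprn_ge0 ?expR_ge0//.
case: m => [|m]; first by rewrite !expr0n.
by apply: ler_weXn2l; rewrite ?ler1n.
Qed.

Section Point.
Variables (al c : R) (B n : nat).
Hypotheses (al01 : 0 < al <= 1) (B0 : (0 < B)%N).
Hypotheses (Bal1 : B%:R ^+ 4 * al <= 1) (Bal2 : 1 <= 16 * (B%:R ^+ 4 * al)).
Hypothesis nE : n%:R = moment 1 al.
Hypothesis minor : forall th, `|th| <= pi ->
  6 * moment 2 al <= th ^+ 2 * moment 4 al ->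
  c * B%:R <= tsum (fun m => coef S m * expR (- al) ^+ m * (1 - cos (m%:R * th))).

Let rho := expR (- al).
Let x := 1 - rho.
Let M2 := moment 2 al.
Let M4 := moment 4 al.
Let mu := relerr M2 M4 x.
Let A := tsum (fun m => coef S m * rho ^+ m).
Let p m : R := (num_partitions_in S m)%:R.
Let cf m : R := expR (- A) * (p m * rho ^+ m).
Let err := expR (- (c * B%:R)).

Let al0 : 0 < al. Proof. by case/andP: al01. Qed.
Let rho01 : 0 <= rho < 1. Proof. exact: expRN_itv. Qed.
Let x01 : 0 < x <= 1.
Proof. by have /andP[r0 r1] := rho01; rewrite subr_gt0 r1 gerBl. Qed.
Let M20 : 0 < M2.
Proof.
apply: lt_le_trans (moment2_ge al0 B0 Bal1).
by rewrite mulr_gt0 ?expR_gt0// exprn_gt0// ltr0n.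
Qed.

(** The real part of the integrand divided by [Psi(rho)]. The saddle point equation says that
    [moment 1 al * t] is [n t], so the factor [z^(-n)] removes exactly the linear part of the
    phase. *)
Let full t := expR (- tsum (fun m => coef S m * rho ^+ m * (1 - cos (m%:R * t)))) *
  (cos (tsum (fun m => coef S m * rho ^+ m * sin (m%:R * t)) - moment 1 al * t - t) -
   (1 - x) * cos (tsum (fun m => coef S m * rho ^+ m * sin (m%:R * t)) - moment 1 al * t)).

Let sp : abs_summable (fun m => p m * rho ^+ m).
Proof. exact: (partition_series_eq_exp S rho01).1. Qed.

Let trig m t := cos ((m%:R - n.+1%:R) * t) - rho * cos ((m.+1%:R - n.+1%:R) * t).

Let trig_le2 m t : `|trig m t| <= 2.
Proof.
have /andP[r0 r1] := rho01.
apply: le_trans (ler_normB _ _) _; rewrite (_ : 2 = 1 + 1 * 1); last by ring.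
apply: lerD; first exact: abs_cos_le1.
by rewrite normrM ler_pM// ?abs_cos_le1// ger0_norm// ltW.
Qed.

Let full_tsum t : full t = tsum (fun m => cf m * trig m t).
Proof.
have [_ H] := partition_series_eq_exp S rho01.
have s1 psi : abs_summable (fun m => p m * rho ^+ m * cos (m%:R * t - psi)).
  apply: (summable_le sp) => m; have /andP[r0 _] := rho01.
  have pr : 0 <= p m * rho ^+ m by rewrite mulr_ge0// exprn_ge0.
  by rewrite normrM (ger0_norm pr) -[leRHS]mulr1 ler_wpM2l// abs_cos_le1.
have -> : tsum (fun m => cf m * trig m t) =
    expR (- A) * (tsum (fun m => p m * rho ^+ m * cos (m%:R * t - n.+1%:R * t)) -
                  rho * tsum (fun m => p m * rho ^+ m * cos (m%:R * t - n%:R * t))).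
  rewrite -(tsumZ rho)// -tsumB//; last exact: summableZ.
  rewrite -tsumZ; last by apply: summableB => //; exact: summableZ.
  apply: eq_tsum => m; rewrite /cf /trig.
  have -> : (m.+1%:R - n.+1%:R) * t = m%:R * t - n%:R * t by rewrite -!natr1; ring.
  have -> : (m%:R - n.+1%:R) * t = m%:R * t - n.+1%:R * t by ring.
  by move: (rho ^+ m) => q; ring.
rewrite !H /full -nE.
have -> : - tsum (fun m => coef S m * rho ^+ m * (1 - cos (m%:R * t))) =
    - A + tsum (fun m => coef S m * rho ^+ m * cos (m%:R * t)).
  by rewrite -(log_modulus_drop al0 t) opprB addrC.
rewrite expRD /x.
set V := tsum (fun m => coef S m * rho ^+ m * sin _).
have -> : V - n.+1%:R * t = V - n%:R * t - t by rewrite -natr1; ring.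
by ring.
Qed.

Let mu_ge : M4 / M2 ^+ 2 <= mu /\ M2^-1 <= mu.
Proof.
have /andP[x0 x1] := x01; have M2' := ltW M20.
have M40 : 0 <= M4 by apply: le_trans (moment2_le_moment4 al0); exact: ltW.
have K0 : 0 <= M4 / M2 ^+ 2 by rewrite divr_ge0// exprn_ge0.
have x2 : 0 < x ^+ 2 <= 1 by rewrite exprn_gt0//= exprn_ile1// ltW.
have L0 : M2^-1 <= (M2 * x ^+ 2)^-1.
  have /andP[x20 x21] := x2.
  by rewrite lef_pV2 ?posrE ?mulr_gt0// ler_piMr.
have L1 : 0 <= M2^-1 by rewrite invr_ge0.
by rewrite /mu /relerr; split; lra.
Qed.

Let pointwise t : `|t| <= pi ->
  `|full t - x * expR (- (t ^+ 2 * M2) / 2)| <=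
  300 * x * mu * expR (- (t ^+ 2 * M2) / 8) + 2 * err.
Proof.
move=> tpi; have /andP[x0 x1] := x01.
have e0 : 0 <= err := expR_ge0 _.
have M40 : 0 < M4 by apply: lt_le_trans M20 (moment2_le_moment4 al0).
have [tQ|tQ] := leP (t ^+ 2 * M4) (6 * M2).
  apply: (@le_trans _ _ (300 * x * mu * expR (- (t ^+ 2 * M2) / 8))); last by lra.
  apply: (@major_arc R M2 (moment 3 al) M4) => //.
  - by apply: tsum_ge0 => [m|]; [exact: moment_term_ge0|exact: summable_moment].
  - exact: ltW.
  - exact: moment3_sqr_le.
  - exact: phase_le.
  - exact: drop_ge.
  - exact: drop_le.
have mn := minor tpi (ltW tQ).
have [mu1 mu2] := mu_ge.
have T0 : 0 < t ^+ 2 * M2.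
  have t2 := sqr_ge0 t; rewrite mulr_gt0// lt_neqAle t2 andbT eq_sym.
  by apply/eqP => tz; move: tQ M20; rewrite tz mul0r => u v; lra.
(* On the minor arc the first term of [mu] suffices, by [t^2 M4 > 6 M2]. *)
have muT : 4 <= mu * (t ^+ 2 * M2).
  apply: (@le_trans _ _ (M4 / M2 ^+ 2 * (t ^+ 2 * M2))); last by rewrite ler_wpM2r// ltW.
  have -> : M4 / M2 ^+ 2 * (t ^+ 2 * M2) = t ^+ 2 * M4 / M2 by field; rewrite gt_eqF.
  by rewrite ler_pdivlMr//; apply: le_trans (ltW tQ); rewrite ler_wpM2r ?(ltW M20)//; lra.
have g := gauss_tail_le T0 muT.
have g0 := expR_ge0 (- (t ^+ 2 * M2) / 2).
apply: le_trans (ler_normB _ _) _; rewrite addrC; apply: lerD.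
  rewrite normrM (gtr0_norm x0) (ger0_norm g0).
  apply: (@le_trans _ _ (x * (mu * expR (- (t ^+ 2 * M2) / 8)))); first by rewrite ler_wpM2l// ltW.
  have h0 : 0 <= x * (mu * expR (- (t ^+ 2 * M2) / 8)).
    by rewrite mulr_ge0 ?(ltW x0)//; apply: le_trans g.
  by move: h0; move: (expR _) => E h0; lra.
rewrite /full normrM (ger0_norm (expR_ge0 _)) mulrC; apply: ler_pM => //; rewrite ?expR_ge0//.
  apply: le_trans (ler_normB _ _) _; rewrite (_ : 2 = 1 + 1 * 1); last by ring.
  apply: lerD; first exact: abs_cos_le1.
  rewrite normrM ler_pM// ?abs_cos_le1// ger0_norm; lra.
by rewrite /err ler_expR lerN2.
Qed.

Let outside t : pi < `|t| ->
  `|x * expR (- (t ^+ 2 * M2) / 2)| <= 300 * x * mu * expR (- (t ^+ 2 * M2) / 8).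
Proof.
move=> tpi; have /andP[x0 x1] := x01; have [mu1 mu2] := mu_ge.
have t4 : 4 <= t ^+ 2.
  by rewrite -(sqr_abs t); have := @pi_ge2 R; nra.
have T0 : 0 < t ^+ 2 * M2 by rewrite mulr_gt0//; lra.
have muT : 4 <= mu * (t ^+ 2 * M2).
  (* Outside the circle the second term of [mu] takes over: it is at least [1 / M2], and
     [t^2 >= 4]. *)
  apply: (@le_trans _ _ (M2^-1 * (t ^+ 2 * M2))); last by rewrite ler_wpM2r// ltW.
  by rewrite mulrCA mulVf ?mulr1// gt_eqF.
have g := gauss_tail_le T0 muT.
have g0 := expR_ge0 (- (t ^+ 2 * M2) / 2).
rewrite normrM (gtr0_norm x0) (ger0_norm g0).
apply: (@le_trans _ _ (x * (mu * expR (- (t ^+ 2 * M2) / 8)))); first by rewrite ler_wpM2l// ltW.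
have h0 : 0 <= x * (mu * expR (- (t ^+ 2 * M2) / 8)).
  by rewrite mulr_ge0 ?(ltW x0)//; apply: le_trans g.
by move: h0; move: (expR _) => E h0; lra.
Qed.

Let cf_ge0 m : 0 <= cf m.
Proof.
have /andP[r0 _] := rho01.
by rewrite mulr_ge0 ?expR_ge0// mulr_ge0// exprn_ge0.
Qed.

(** [M] may depend on [n] and [al], since no estimate after the integration involves it; [err] is
    the error that the minor arc costs anyway. *)
Let truncation : exists2 M, (n.+1 < M)%N &
  forall t, `|full t - cos_poly cf rho n M t| <= err.
Proof.
have scf : abs_summable cf by exact: summableZ.
have e0 : 0 < err := expR_gt0 _.
have /cvgr_dist_lt/(_ (err / 2)) := cvg_tsum_tail scf.
rewrite divr_gt0// => /(_ isT)[N _ NP].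
exists (N + n.+2)%N => [|t]; first by rewrite ltn_addl.
have := NP (N + n.+2)%N; rewrite /= leq_addr sub0r normrN => /(_ isT) tl.
have sct : abs_summable (fun m => cf m * trig m t).
  apply: (@summable_le _ (fun m => 2 * cf m)); first exact: summableZ.
  by move=> m; rewrite normrM (ger0_norm (cf_ge0 m)) mulrC ler_wpM2r.
rewrite full_tsum /cos_poly.
apply: le_trans (norm_tsum_sub_partial _ sct) _.
rewrite (tsum_split (N + n.+2) (summable_norm sct)) addrAC subrr add0r.
move: tl; rewrite (tsum_split (N + n.+2) scf) addrAC subrr add0r => tl.
have sct2 : abs_summable (fun m => if (N + n.+2 <= m)%N then cf m else 0).
  exact: summable_tail.
apply: (@le_trans _ _ (2 * tsum (fun m => if (N + n.+2 <= m)%N then cf m else 0))).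
  rewrite -tsumZ//; apply: le_tsum.
  - move=> m; case: ifP => _; last by rewrite mulr0.
    by rewrite normrM (ger0_norm (cf_ge0 m)) mulrC ler_wpM2r.
  - exact/summable_tail/summable_norm.
  - exact: summableZ.
have := le_lt_trans (ler_norm _) tl; lra.
Qed.

Lemma saddle_point_integral :
  `|2 * pi * expR (- A) * rho ^+ n.+1 * (p n.+1 - p n) - x * Num.sqrt (2 * pi / M2)| <=
  600 * x * mu * Num.sqrt (2 * pi / M2) + 6 * pi * err.
Proof.
have [M nM ap] := truncation.
(* [3 * err] is [2 * err] from the minor arc plus [err] from truncation. *)
have := @integral_near_gauss R (cos_poly cf rho n M) M2 x (300 * x * mu) (3 * err)
  (@continuous_cos_poly _ _ _ _ _) M20.
rewrite integral_cos_poly//.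
have -> : 2 * pi * (cf n.+1 - rho * cf n) = 2 * pi * expR (- A) * rho ^+ n.+1 * (p n.+1 - p n).
  by rewrite /cf exprS; move: (rho ^+ n) => q; ring.
have -> : 300 * x * mu * (2 * Num.sqrt (2 * pi / M2)) + 2 * pi * (3 * err) =
  600 * x * mu * Num.sqrt (2 * pi / M2) + 6 * pi * err by ring.
apply => // t tpi.
have := pointwise tpi; have := ap t; rewrite distrC => h1 h2.
have := ler_normD (cos_poly cf rho n M t - full t) (full t - x * expR (- (t ^+ 2 * M2) / 2)).
rewrite addrA subrK; lra.
Qed.

End Point.

End SaddlePoint.

(** * From powers of [B] to powers of [n] *)

Section Asymptotics.
Context {R : realType}.
Notation S := sums_of_two_squares.

Lemma sqrt_le_1D (y : R) : 0 <= y -> Num.sqrt y <= 1 + y.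
Proof.
move=> y0; have := sqr_sqrtr y0; have := sqrtr_ge0 y.
by move: (Num.sqrt y) => r r0 <-; nra.
Qed.

Lemma minor_arc_negligible (c : R) : 0 < c -> exists2 C : R, 0 <= C &
  forall (al : R) (B : nat), 0 < al <= 1 -> (0 < B)%N ->
  B%:R ^+ 4 * al <= 1 -> 1 <= 16 * (B%:R ^+ 4 * al) ->
  3 * Num.sqrt (2 * pi * moment 2 al) * expR (- (c * B%:R)) <=
  (1 - expR (- al)) * (C / B%:R ^+ 2).
Proof.
move=> c0; have [K K0 KE] : exists2 K : R, 0 <= K & quartic_pow_const = K.
  by exists quartic_pow_const => //; have := @quartic_pow_const_ge16 R; lra.
(* The power 26 is [20 + 4 + 2]: a crude [B^20] for the square root of the second moment, [B^4] for
   dividing by [1 - rho], and [B^2] for the target precision. *)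
have [D D0 DE] : exists2 D : R, 0 <= D & forall y : R, 0 <= y -> y ^+ 26 * expR (- y) <= D.
  exists (26%:R ^+ 26); first by rewrite exprn_ge0.
  by move=> y y0; exact: exp_mul_pow_le.
have C0 : 0 <= 96 * (1 + 8 * K) * (D / c ^+ 26).
  by rewrite !mulr_ge0 ?addr_ge0 ?mulr_ge0 ?invr_ge0 ?exprn_ge0// ltW.
exists (96 * (1 + 8 * K) * (D / c ^+ 26)) => // al B al01 B0 Bal1 Bal2.
have /andP[a0 a1] := al01.
have b1 : 1 <= B%:R :> R by rewrite ler1n.
have b0 : 0 < B%:R :> R by lra.
have M4 := moment4_le_pow a0 Bal2; rewrite KE in M4.
have M2 := le_trans (moment2_le_moment4 a0) M4.
have M20 : 0 <= moment 2 al.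
  by apply: tsum_ge0 => [m|]; [exact: moment_term_ge0|exact: summable_moment].
have pi0 := @pi_gt0 R; have pi4 : pi < 4 :> R by have := @pihalf_lt2 R; lra.
set q := Num.sqrt _; set e := expR (- (c * B%:R)).
have e0 : 0 <= e := expR_ge0 _.
have q1 : q <= (1 + 8 * K) * B%:R ^+ 20.
  apply: (@le_trans _ _ (1 + 8 * moment 2 al)).
    apply: le_trans (sqrt_le_1D _) _; first by rewrite !mulr_ge0// ltW.
    by rewrite lerD2l; nra.
  have : 1 <= B%:R ^+ 20 :> R by exact: exprn_ege1.
  by move: M2; move: (B%:R ^+ 20) => u h1 h2; lra.
have ce : B%:R ^+ 26 * e <= D / c ^+ 26.
  rewrite ler_pdivlMr ?exprn_gt0//.
  have y0 : 0 <= c * B%:R by rewrite mulr_ge0 ?ltW.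
  by have := DE _ y0; rewrite exprMn -/e; move: (B%:R ^+ 26) (c ^+ 26) => u v; lra.
have xl := one_sub_expN_ge al01.
have xb : (32 * B%:R ^+ 4)^-1 <= 1 - expR (- al).
  apply: le_trans xl; rewrite -[leLHS]mul1r ler_pdivrMr ?mulr_gt0 ?exprn_gt0//.
  by move: (B%:R ^+ 4) Bal2 => u; lra.
apply: (@le_trans _ _ ((32 * B%:R ^+ 4)^-1 * (96 * (1 + 8 * K) * (D / c ^+ 26) / B%:R ^+ 2))); last first.
  by apply: ler_wpM2r => //; rewrite divr_ge0// exprn_ge0// ltW.
apply: (@le_trans _ _ (3 * ((1 + 8 * K) * B%:R ^+ 20) * e)).
  by apply: ler_wpM2r => //; apply: ler_wpM2l.
have bn0 : B%:R != 0 :> R by rewrite gt_eqF.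
have -> : 3 * ((1 + 8 * K) * B%:R ^+ 20) * e =
    3 * (1 + 8 * K) / B%:R ^+ 6 * (B%:R ^+ 26 * e).
  by move: e {e0 ce} => e; field.
have cn0 : c != 0 by rewrite gt_eqF.
have -> : (32 * B%:R ^+ 4)^-1 * (96 * (1 + 8 * K) * (D / c ^+ 26) / B%:R ^+ 2) =
    3 * (1 + 8 * K) / B%:R ^+ 6 * (D / c ^+ 26).
  by move: (D / c ^+ 26) => d; field.
apply: ler_wpM2l => //.
by rewrite divr_ge0 ?mulr_ge0 ?addr_ge0 ?mulr_ge0 ?exprn_ge0// ltW.
Qed.

Lemma saddle_point_asymptotics : exists2 C : R, 0 <= C &
  forall (al : R) (B n : nat), 0 < al <= 1 -> (0 < B)%N ->
  B%:R ^+ 4 * al <= 1 -> 1 <= 16 * (B%:R ^+ 4 * al) -> n%:R = moment 1 al ->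
  `|expR (- tsum (fun m => coef S m * expR (- al) ^+ m)) * expR (- al) ^+ n.+1 *
    ((num_partitions_in S n.+1)%:R - (num_partitions_in S n)%:R) *
    Num.sqrt (2 * pi * moment 2 al) - (1 - expR (- al))| <=
  (1 - expR (- al)) * (C / B%:R ^+ 2).
Proof.
have [c c0 minor] := @minor_arc R.
have [C C0 neg] := minor_arc_negligible c0.
have [K K0 KE] : exists2 K : R, 0 <= K & @Krel R = K.
  exists (@Krel R); last by [].
  apply: addr_ge0; apply: mulr_ge0; try exact: expR_ge0.
    by have := @quartic_pow_const_ge16 R; lra.
  exact: ler0n.
exists (600 * K + C); first by lra.
move=> al B n al01 B0 Bal1 Bal2 nE.
have /andP[a0 a1] := al01.
have mn th := @minor al th B a0 B0 Bal1 Bal2.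
have := saddle_point_integral al01 B0 Bal1 nE mn.
have mu := relerr_le al01 B0 Bal1 Bal2; rewrite KE in mu.
have ng := neg _ _ al01 B0 Bal1 Bal2.
have M20 : 0 < moment 2 al.
  apply: lt_le_trans (moment2_ge a0 B0 Bal1).
  by rewrite mulr_gt0 ?expR_gt0// exprn_gt0// ltr0n.
have pi0 := @pi_gt0 R.
have x0 : 0 <= 1 - expR (- al).
  by have := one_sub_expN_ge al01; lra.
set x := 1 - expR (- al) in mu ng x0 *.
set m := relerr _ _ _ in mu *.
set X := expR _ * _ ^+ _ * _.
have -> : 2 * pi * expR (- tsum (fun m => coef S m * expR (- al) ^+ m)) *
  expR (- al) ^+ n.+1 *
  ((num_partitions_in S n.+1)%:R - (num_partitions_in S n)%:R) = 2 * pi * X.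
  by rewrite /X !mulrA.
set s := Num.sqrt (2 * pi / moment 2 al).
set q := Num.sqrt (2 * pi * moment 2 al) in ng *.
set e := expR (- (c * B%:R)) in ng *.
have s0 : 0 < s by rewrite sqrtr_gt0 divr_gt0// mulr_gt0.
(* This factorisation lets the Gaussian mass [s] cancel and leaves the square root [q] of the
   theorem next to the difference of partition numbers. *)
have sq : 2 * pi = s * q.
  rewrite /s /q -sqrtrM; last by rewrite divr_ge0 ?mulr_ge0 ?ltW.
  rewrite (_ : 2 * pi / moment 2 al * (2 * pi * moment 2 al) = (2 * pi) ^+ 2); last by field; rewrite gt_eqF.
  by rewrite sqrtr_sqr ger0_norm// mulr_ge0// ltW.
have -> : 6 * pi * e = s * (3 * q * e).
  have -> : 6 * pi * e = 3 * (2 * pi) * e by ring.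
  by rewrite sq; ring.
rewrite sq (_ : s * q * X - x * s = s * (X * q - x)); last by ring.
rewrite (_ : 600 * x * m * s = s * (600 * x * m)); last by ring.
rewrite -mulrDr normrM (gtr0_norm s0) ler_pM2l// => h.
apply: le_trans h _.
have -> : x * ((600 * K + C) / B%:R ^+ 2) = 600 * x * (K / B%:R ^+ 2) + x * (C / B%:R ^+ 2).
  by move: (_^-1) => u; ring.
apply: lerD; last exact: ng.
by apply: ler_wpM2l mu; lra.
Qed.

(** [B] is the largest integer with [B^4 al <= 1]; the factor 16 comes from [B + 1 <= 2 B]. *)
Lemma exists_fourth_root (al : R) : 0 < al <= 1 -> exists2 B : nat, (0 < B)%N &
  B%:R ^+ 4 * al <= 1 /\ 1 <= 16 * (B%:R ^+ 4 * al).
Proof.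
move=> /andP[a0 a1].
have exP : exists b : nat, b%:R ^+ 4 * al <= 1 by exists 0%N; rewrite expr0n/= mul0r ler01.
have ubP b : b%:R ^+ 4 * al <= 1 -> (b <= Num.bound al^-1)%N.
  move=> h; rewrite -(ler_nat R); case: b h => [//|b] h.
  have : b.+1%:R <= al^-1.
    rewrite -[leRHS]mul1r ler_pdivlMr//; apply: le_trans h; rewrite ler_wpM2r ?(ltW a0)//.
    by rewrite -{1}(expr1 b.+1%:R); apply: ler_weXn2l; rewrite ?ler1n.
  move=> /le_trans; apply; apply: ltW; apply: le_lt_trans (archi_boundP _).
    by [].
  by rewrite invr_ge0 ltW.
have [B hB hmax] := ex_maxnP exP ubP.
have B0 : (0 < B)%N by apply: hmax; rewrite expr1n mul1r.
exists B => //; split => //.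
have : 1 < B.+1%:R ^+ 4 * al.
  by rewrite ltNge; apply/negP => /hmax; rewrite ltnn.
move=> h; apply: le_trans (ltW h) _; rewrite mulrA ler_wpM2r ?(ltW a0)//.
have -> : 16 * B%:R ^+ 4 = (2 * B%:R) ^+ 4 :> R by rewrite exprMn; congr (_ * _); ring.
apply: lerXn2r; rewrite ?nnegrE ?mulr_ge0// -natrM ler_nat; lia.
Qed.

Lemma expR_sub1_le (al : R) : 0 < al <= 1 -> 0 <= expR al - 1 - al <= al ^+ 2 * expR 1.
Proof.
move=> /andP[a0 a1]; apply/andP; split; first by have := expR_ge1Dx al; lra.
have e1 : expR al <= expR 1 by rewrite ler_expR.
have : expR al - 1 <= al * expR al.
  by have := @expR_sub_le R 0 al (ltW a0); rewrite expR0 subr0.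
have := expR_ge1Dx al; have := expR_gt0 al; nra.
Qed.

Lemma euler_op_Phi (al : R) : 0 < al -> euler_op (@Phi R) (expR (- al)) = moment 1 al.
Proof.
move=> a0; have r01 : 0 < expR (- al) < 1 by rewrite expR_gt0; case/andP: (expRN_itv a0).
transitivity (tsum (fun m => m%:R * coef S m * expR (- al) ^+ m)); last first.
  by apply: eq_tsum => m; rewrite expr1.
apply: (@euler_op_power_series R 1 1 (coef S)) => //.
- by move=> m; rewrite ger0_norm ?coef_ge0// mul1r expr1 coef_le.
- by move=> y /andP[y0 y1]; rewrite Phi_tsum// y1 ltW.
Qed.

Lemma euler_op2_Phi (al : R) : 0 < al ->
  euler_op (euler_op (@Phi R)) (expR (- al)) = moment 2 al.
Proof.
move=> a0; have r01 : 0 < expR (- al) < 1 by rewrite expR_gt0; case/andP: (expRN_itv a0).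
transitivity (tsum (fun m => m%:R * (m%:R * coef S m) * expR (- al) ^+ m)); last first.
  by apply: eq_tsum => m; rewrite expr2 !mulrA.
apply: (@euler_op_power_series R 2 1 (fun m => m%:R * coef S m)) => //.
- move=> m; rewrite ger0_norm ?mulr_ge0 ?coef_ge0// mul1r expr2.
  by rewrite ler_wpM2l// coef_le.
- move=> y /andP[y0 y1]; have l0 : 0 < - ln y by rewrite oppr_gt0 ln_lt0// y0.
  have yE : y = expR (- (- ln y)) by rewrite opprK lnK.
  rewrite yE euler_op_Phi//; apply: eq_tsum => m; by rewrite expr1 -yE.
Qed.

(** Here [n^(-1/4)] is weakened to [n^(-1/5)]: [1024 B^8 <= 1024 B^10 = (4 B^2)^5]. *)
Lemma inv_sqr_le_powR (n B : nat) : (0 < n)%N -> (0 < B)%N ->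
  n%:R <= 1024 * B%:R ^+ 8 :> R -> (B%:R ^+ 2)^-1 <= 4 * n%:R `^ (- (1 / 5)) :> R.
Proof.
move=> n0 B0 nB; have b1 : 1 <= B%:R :> R by rewrite ler1n.
have n0' : 0 < n%:R :> R by rewrite ltr0n.
have b2 : 0 < B%:R ^+ 2 :> R by rewrite exprn_gt0//; lra.
have h : n%:R <= (4 * B%:R ^+ 2) ^+ 5 :> R.
  apply: le_trans nB _.
  have -> : (4 * B%:R ^+ 2) ^+ 5 = 1024 * B%:R ^+ 10 :> R by move: (B%:R : R) => b; ring.
  by apply: ler_wpM2l; [exact: ler0n|exact: ler_weXn2l].
have : n%:R `^ (1 / 5) <= ((4 * B%:R ^+ 2) ^+ 5) `^ (1 / 5) :> R.
  by apply: ge0_ler_powR; rewrite ?nnegrE// ?divr_ge0// ?exprn_ge0// ?mulr_ge0// ltW.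
rewrite -powR_mulrn; last by rewrite mulr_ge0// ltW.
rewrite -powRrM (_ : 5%:R * (1 / 5) = 1 :> R); last by field.
rewrite powRr1; last by rewrite mulr_ge0// ltW.
have p0 : 0 < n%:R `^ (1 / 5) :> R by rewrite powR_gt0.
rewrite powRN => h2.
rewrite -[leLHS]mul1r ler_pdivrMr// mulrAC ler_pdivlMr//; lra.
Qed.

End Asymptotics.

Theorem theorem3p3 (R : realType) (rho : nat -> R)
  (rhoP : \forall n \near \oo,
     0 < rho n < 1 /\ n%:R = rho n * derive1 (@Phi R) (rho n)) :
  exists2 E : nat -> R,
    E =O_\oo (fun n => n%:R `^ (- (1 / 5))) &
    \forall n \near \oo,
      (num_partitions_in sums_of_two_squares n.+1)%:R
        - (num_partitions_in sums_of_two_squares n)%:R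
      = rho n ^- n * ln (1 / rho n) * Psi (rho n)
          / Num.sqrt (2 * pi * euler_op (euler_op (@Phi R)) (rho n))
        * (1 + E n).
Proof.
pose Delta n : R := (num_partitions_in sums_of_two_squares n.+1)%:R
        - (num_partitions_in sums_of_two_squares n)%:R.
pose main n : R := rho n ^- n * ln (1 / rho n) * Psi (rho n)
          / Num.sqrt (2 * pi * euler_op (euler_op (@Phi R)) (rho n)).
have [C C0 asy] := @saddle_point_asymptotics R.
have e10 : 0 < expR 1 :> R := expR_gt0 _.
pose K : R := expR 1 + (1 + expR 1) * C.
have K0 : 0 < K by rewrite /K ltr_wpDr// mulr_ge0// addr_ge0// ltW.
have key n : (4 <= n)%N -> 0 < rho n < 1 -> n%:R = rho n * derive1 (@Phi R) (rho n) ->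
    main n != 0 /\ `|Delta n / main n - 1| <= 4 * K * n%:R `^ (- (1 / 5)).
  move=> n4 /andP[r0 r1] nE; pose al := - ln (rho n).
  have a0 : 0 < al by rewrite oppr_gt0 ln_lt0// r0.
  have rE : rho n = expR (- al) by rewrite opprK lnK.
  have nM : n%:R = moment 1 al by rewrite -(euler_op_Phi a0) -rE /euler_op; exact: nE.
  have n4' : 4 <= n%:R :> R by rewrite ler_nat.
  have nal : n%:R * al ^+ 2 <= 4.
    by have := moment1_le a0; rewrite -nM ler_pdivlMr// exprn_gt0.
  (* This is the purpose of [4 <= n]: together with [n al^2 <= 4] it forces [al <= 1]. *)
  have a1 : al <= 1 by nra.
  have al01 : 0 < al <= 1 by rewrite a0.
  have [B B0 [Bal1 Bal2]] := exists_fourth_root al01.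
  have b1 : 1 <= B%:R :> R by rewrite ler1n.
  have := asy al B n al01 B0 Bal1 Bal2 nM.
  have lnE : ln (1 / rho n) = al by rewrite div1r lnV ?posrE.
  have PhiE : Phi (rho n) = tsum (fun m => coef sums_of_two_squares m * expR (- al) ^+ m).
    by rewrite Phi_tsum -?rE// r1 ltW.
  have M20 : 0 < moment 2 al.
    apply: lt_le_trans (moment2_ge a0 B0 Bal1).
    by rewrite mulr_gt0 ?expR_gt0// exprn_gt0// ltr0n.
  have mainE : main n = (expR (- al) ^+ n)^-1 * al *
      expR (tsum (fun m => coef sums_of_two_squares m * expR (- al) ^+ m)) /
      Num.sqrt (2 * pi * moment 2 al).
    by rewrite /main lnE /Psi PhiE rE euler_op2_Phi.
  have q0 : 0 < Num.sqrt (2 * pi * moment 2 al) by rewrite sqrtr_gt0 !mulr_gt0// pi_gt0.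
  have main0 : 0 < main n.
    by rewrite mainE divr_gt0// !mulr_gt0// ?invr_gt0 ?exprn_gt0 ?expR_gt0.
  rewrite -/(Delta n); set A := tsum _ in mainE *; set q := Num.sqrt _ in mainE q0 *.
  have aB : al <= (B%:R ^+ 2)^-1.
    rewrite -[leRHS]mul1r ler_pdivlMr ?exprn_gt0//; last lra.
    apply: le_trans Bal1; rewrite mulrC ler_wpM2r ?(ltW a0)//.
    exact: ler_weXn2l.
  have ib0 : 0 <= (B%:R ^+ 2)^-1 :> R by rewrite invr_ge0 exprn_ge0.
  have ib1 : (B%:R ^+ 2)^-1 <= 1 :> R by rewrite invf_le1 ?exprn_ege1// exprn_gt0//; lra.
  have /andP[d0 d1] := expR_sub1_le al01.
  have x0 : 0 < 1 - expR (- al) by have := one_sub_expN_ge al01; lra.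
  set y := expR (- A) * _ ^+ _ * _ * _ => hy.
  (* The first factor carries the saddle point error; the second replaces [(1 - rho) / rho] by
     [log(1 / rho) = al]. Both are 1 up to [O(B^(-2))]. *)
  have DE : Delta n / main n = y / (1 - expR (- al)) * ((expR al - 1) / al).
    have eA : expR (- A) = (expR A)^-1 by rewrite expRN.
    have ea : expR (- al) = (expR al)^-1 by rewrite expRN.
    have A0 := expR_gt0 A; have al0' := expR_gt0 al.
    have ea1 : expR al - 1 != 0 by rewrite gt_eqF// subr_gt0 -[ltLHS]expR0 ltr_expR.
    rewrite mainE /y exprSr eA.
    have rn0 : expR (- al) ^+ n != 0 by rewrite gt_eqF// exprn_gt0// expR_gt0.
    move: rn0; move: (expR (- al) ^+ n) => u u0; rewrite ea.
    by field; rewrite u0 ea1 !gt_eqF.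
  split; first by rewrite gt_eqF.
  have z1 : `|y / (1 - expR (- al)) - 1| <= C / B%:R ^+ 2.
    rewrite -(ler_pM2l x0); apply: le_trans hy.
    by rewrite -{1}(gtr0_norm x0) -normrM mulrBr mulr1 mulrCA mulfV ?mulr1// gt_eqF.
  have z2 : `|(expR al - 1) / al - 1| <= expR 1 / B%:R ^+ 2.
    have -> : (expR al - 1) / al - 1 = (expR al - 1 - al) / al by field; rewrite gt_eqF.
    rewrite ger0_norm; last by rewrite divr_ge0// ltW.
    rewrite ler_pdivrMr//; apply: le_trans d1 _.
    by rewrite expr2 mulrC mulrA ler_wpM2r ?(ltW a0)// ler_wpM2l// ltW.
  have nB : n%:R <= 1024 * B%:R ^+ 8 :> R.
    have a2 : 0 < al ^+ 2 by rewrite exprn_gt0.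
    rewrite -(ler_pM2r a2); apply: le_trans nal _.
    have -> : 1024 * B%:R ^+ 8 * al ^+ 2 = 4 * (16 * (B%:R ^+ 4 * al)) ^+ 2.
      by move: (B%:R : R) => b; ring.
    by rewrite -[leLHS]mulr1 ler_wpM2l// exprn_ege1.
  have n0 : (0 < n)%N by exact: leq_trans n4.
  have powB := inv_sqr_le_powR n0 B0 nB.
  apply: (@le_trans _ _ (K * (B%:R ^+ 2)^-1)); last first.
    by rewrite (mulrC 4) -mulrA ler_wpM2l// ltW.
  rewrite DE; move: z1 z2.
  move: (y / _) ((expR al - 1) / al) => u v z1 z2.
  have -> : u * v - 1 = (u - 1) * (v - 1) + (u - 1) + (v - 1) by ring.
  apply: le_trans (ler_normD _ _) _.
  apply: le_trans (lerD (ler_normD _ _) (lexx _)) _.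
  rewrite normrM /K; move: (`|u - 1|) (`|v - 1|) (normr_ge0 (u - 1)) (normr_ge0 (v - 1)) z1 z2.
  move: ((B%:R ^+ 2)^-1) ib0 ib1 => i i0 i1 U V U0 V0 UC VE.
  have h1 : U * V <= C * i * expR 1.
    apply: ler_pM => //; apply: le_trans VE _.
    by rewrite -[leRHS]mulr1 ler_wpM2l// ltW.
  by rewrite mulrDl; lra.
(* The exact relative error; it is meaningful for large [n], where [key] shows that the main term is
   nonzero. *)
exists (fun n => Delta n / main n - 1).
  apply/eqO_exP; exists (4 * K); first by rewrite mulr_gt0.
  near=> n; rewrite [leRHS](_ : _ = 4 * K * n%:R `^ (- (1 / 5))); last first.
    by rewrite ger0_norm// powR_ge0.
  have [r01 nE] : 0 < rho n < 1 /\ n%:R = rho n * derive1 (@Phi R) (rho n).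
    by near: n; exact: rhoP.
  have n4 : (4 <= n)%N by near: n; exact: nbhs_infty_ge.
  by have [] := key n n4 r01 nE.
near=> n; rewrite -/(Delta n) -/(main n).
have [r01 nE] : 0 < rho n < 1 /\ n%:R = rho n * derive1 (@Phi R) (rho n).
  by near: n; exact: rhoP.
have n4 : (4 <= n)%N by near: n; exact: nbhs_infty_ge.
have [main0 _] := key n n4 r01 nE.
by rewrite addrC subrK mulrC divfK.
Unshelve. all: by end_near.
Qed.
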